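(* Let $R$ be a commutative ring and let $X^{\cdot}$ be an $\mathcal R$-module scheme. Then $X^{\cdot}$ is isomorphic (as an $\mathcal R$-module) to $\mathcal M^*$ for some $R$-module $M$ if and only if $X^{\cdot}$ is a reflexive $\mathcal R$-module affine scheme (that is, $X$ is affine and $X^{\cdot}$ is a reflexive $\mathcal R$-module).
   Context: All functors are covariant functors on the category of commutative $R$-algebras. $\mathcal R$ is the functor of rings $\mathcal R(R'):=R'$. An $\mathcal R$-module $\mathbb M$ is a functor of abelian groups with a morphism of functors $\mathcal R\times\mathbb M\to\mathbb M$ making each $\mathbb M(R')$ an $R'$-module; a morphism of $\mathcal R$-modules is a natural transformation that is $R'$-linear for every $R'$. For an $R'$-algebra $R''$, $\mathbb M_{|R'}(R''):=\mathbb M(R'')$. The dual is $\mathbb M^*:=\mathbb{H}om_{\mathcal R}(\mathbb M,\mathcal R)$, i.e. $\mathbb M^*(R'):=\mathrm{Hom}_{\mathcal R'}(\mathbb M_{|R'},\mathcal R')$, where $\mathcal R'=\mathcal R_{|R'}$. $\mathbb M$ is reflexive if the natural morphism $\mathbb M\to\mathbb M^{**}$ is an isomorphism. For an $R$-module $M$, $\mathcal M$ denotes the $\mathcal R$-module $\mathcal M(R'):=M\otimes_RR'$; hence $\mathcal M^*(R')=\mathrm{Hom}_{R}(M,R')$. For an $R$-scheme $X$, $X^{\cdot}(R'):=\mathrm{Hom}_{R\text{-}sch}(\mathrm{Spec}\,R',X)$ is its functor of points. An $R$-module scheme is a commutative group $R$-scheme $X$ with a morphism $\mathbb A^1_R\times_R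 X\to X$ satisfying the module axioms; equivalently $X^{\cdot}$ is endowed with an $\mathcal R$-module structure. An $\mathcal R$-module scheme is an $\mathcal R$-module of the form $X^{\cdot}$ for an $R$-module scheme $X$; it is an $\mathcal R$-module affine scheme if $X$ is affine. *)

(* Defs.v *)
From HB Require Import structures.
From mathcomp Require Import all_boot all_order all_algebra.
From mathcomp Require Import boolp classical_sets functions topology_structure.
From mathcomp Require Import ring.

Set Implicit Arguments.
Unset Strict Implicit.
Unset Printing Implicit Defensive.

Import GRing.Theory.
Local Open Scope classical_set_scope.
Local Open Scope ring_scope.
Local Open Scope quotient_scope.

(* Rings are [comPzRingType]s: the zero ring is allowed, as base ring, as      *)
(* algebra, and as ring of sections over the empty set.                        *)

Section Rmorphism.
Variables S T : comPzRingType.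

Section Build.
Variables (f : S -> T) (fD : {morph f : x y / x + y}) (f1 : f 1 = 1).
Variable fM : {morph f : x y / x * y}.

Lemma morph_add0 : f 0 = 0.
Proof. by apply: (addrI (f 0)); rewrite -fD !addr0. Qed.

Definition mk_rmorphism : {rmorphism S -> T} :=
  HB.pack_for {rmorphism S -> T} f
    (GRing.isNmodMorphism.Build S T f (conj morph_add0 fD))
    (GRing.isMonoidMorphism.Build S T f (conj f1 fM)).

End Build.

Lemma rmorphism_ext (f g : {rmorphism S -> T}) : f =1 g -> f = g.
Proof.
move=> /funext; case: f => f [[f1] [f2]]; case: g => g [[g1] [g2]] /= fg.
subst g; rewrite (Prop_irrelevance f1 g1) (Prop_irrelevance f2 g2).
by [].
Qed.

End Rmorphism.

Identity Coercion set_apply : set >-> Funclass.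

Record opens (X : topologicalType) :=
  Opens { opens_set :> set X; opensP : open opens_set }.

Definition opensI (X : topologicalType) (U V : opens X) : opens X :=
  Opens (openI (opensP U) (opensP V)).

Definition preim_opens (X Y : topologicalType) (f : X -> Y)
    (fc : continuous f) (V : opens Y) : opens X :=
  Opens (proj1 (continuousP f) fc V (opensP V)).

Record ringed_space := RingedSpace {
  rs_top :> topologicalType;
  sect : opens rs_top -> comPzRingType;
  res : forall U V : opens rs_top, V `<=` U -> {rmorphism sect U -> sect V};
  res_id : forall (U : opens rs_top) (h : U `<=` U) (s : sect U), res h s = s;
  res_comp : forall (U V W : opens rs_top) (hV : V `<=` U) (hW : W `<=` V)
      (h : W `<=` U) (s : sect U),
    res hW (res hV s) = res h s }.

Lemma res_trans (X : ringed_space) (U V W : opens X) (hV : V `<=` U)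
    (hW : W `<=` V) (s : sect U) :
  res hW (res hV s) = res (subset_trans hW hV) s.
Proof. exact: res_comp. Qed.

Lemma res_irr (X : ringed_space) (U V : opens X) (h h' : V `<=` U)
    (s : sect U) : res h s = res h' s.
Proof. by rewrite (Prop_irrelevance h h'). Qed.

Definition is_sheaf (X : ringed_space) : Prop :=
  forall (I : Type) (U : opens X) (V : I -> opens X)
         (VU : forall i, V i `<=` U), U `<=` \bigcup_i V i ->
    (forall s t : sect U, (forall i, res (VU i) s = res (VU i) t) -> s = t) /\
    (forall s : forall i, sect (V i),
      (forall i j (W : opens X) (hi : W `<=` V i) (hj : W `<=` V j),
         res hi (s i) = res hj (s j)) ->
      exists t : sect U, forall i, res (VU i) t = s i).

(* The germ at x of the section s is a unit of the stalk at x. *)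
Definition germ_unit (X : ringed_space) (U : opens X) (s : sect U) (x : X) :=
  exists (V : opens X) (h : V `<=` U), V x /\ exists t, res h s * t = 1.

(* The stalks are local rings: 1 <> 0, and the nonunits are stable under       *)
(* addition. Any two germs at x have representatives over a common open set.   *)
Definition has_local_stalks (X : ringed_space) : Prop :=
  forall (U : opens X) (x : X), U x ->
    ~ germ_unit (0 : sect U) x /\
    forall s t : sect U,
      germ_unit (s + t) x -> germ_unit s x \/ germ_unit t x.

Record lrs := Lrs {
  lrs_rs :> ringed_space;
  lrs_sheaf : is_sheaf lrs_rs;
  lrs_local : has_local_stalks lrs_rs }.

(* [hom_local] says that the maps induced on stalks are local homomorphisms.   *)
Record lrs_hom (X Y : lrs) := LrsHom {
  hom_fun :> X -> Y;
  hom_cont : continuous hom_fun;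
  hom_pull : forall V : opens Y,
    {rmorphism sect V -> sect (preim_opens hom_cont V)};
  hom_pull_res : forall (V W : opens Y) (h : W `<=` V)
      (h' : preim_opens hom_cont W `<=` preim_opens hom_cont V) (s : sect V),
    hom_pull W (res h s) = res h' (hom_pull V s);
  hom_local : forall (V : opens Y) (s : sect V) (x : X), V (hom_fun x) ->
    germ_unit (hom_pull V s) x -> germ_unit s (hom_fun x) }.

Arguments hom_cont {X Y} _ : rename.
Arguments hom_pull {X Y} _ V.
Arguments hom_pull_res {X Y} _ {V W} h h' s.
Arguments hom_local {X Y} _ {V s x}.

Lemma lrs_hom_ext (X Y : lrs) (f g : lrs_hom X Y) :
  f =1 g ->
  (forall (V : opens Y) (U : opens X) (hf : U `<=` preim_opens (hom_cont f) V)
     (hg : U `<=` preim_opens (hom_cont g) V) (s : sect V),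
     res hf (hom_pull f V s) = res hg (hom_pull g V s)) ->
  f = g.
Proof.
case: f => f fc fp fr fl; case: g => g gc gp gr gl /= /funext fg E; subst g.
move: gp gr gl E; rewrite (Prop_irrelevance gc fc) => gp gr gl E.
have fgp : fp = gp.
  apply: functional_extensionality_dep => V; apply: rmorphism_ext => s.
  by have := E V (preim_opens fc V) (@subset_refl _ _) (@subset_refl _ _) s;
     rewrite !res_id.
subst gp.
by rewrite (Prop_irrelevance fr gr) (Prop_irrelevance fl gl).
Qed.

Section LrsId.
Variable X : lrs.

Lemma id_lrs_cont : continuous (@id X).
Proof. by apply/continuousP. Qed.

Definition id_lrs_pull (V : opens X) :
    {rmorphism sect V -> sect (preim_opens id_lrs_cont V)} :=
  @res X V (preim_opens id_lrs_cont V) (@subset_refl _ _).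

Lemma germ_unit_res (U V : opens X) (h : V `<=` U) (s : sect U) x :
  V x -> germ_unit (res h s) x <-> germ_unit s x.
Proof.
move=> Vx; split=> -[W [hW [Wx [t st]]]].
  have hWU : W `<=` U by move=> y /hW /h.
  exists W, hWU; split=> //; exists t.
  by rewrite -(res_comp h hW).
have hl : opensI W V `<=` W by move=> y [].
have hr : opensI W V `<=` V by move=> y [].
have hU : opensI W V `<=` U by move=> y [/hW].
exists (opensI W V), hr; split=> //; exists (res hl t).
by rewrite (res_comp _ _ hU) -(res_comp hW hl) -rmorphM st rmorph1.
Qed.

Lemma id_lrs_pull_res (V W : opens X) (h : W `<=` V)
    (h' : preim_opens id_lrs_cont W `<=` preim_opens id_lrs_cont V) s :
  id_lrs_pull W (res h s) = res h' (id_lrs_pull V s).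
Proof. rewrite /id_lrs_pull !res_trans; exact: res_irr. Qed.

Lemma id_lrs_local (V : opens X) (s : sect V) x : V x ->
  germ_unit (id_lrs_pull V s) x -> germ_unit s x.
Proof. by move=> Vx /germ_unit_res; apply. Qed.

Definition id_lrs : lrs_hom X X := LrsHom id_lrs_pull_res id_lrs_local.

End LrsId.

Section LrsComp.
Variables (X Y Z : lrs) (g : lrs_hom Y Z) (f : lrs_hom X Y).

Lemma comp_lrs_cont : continuous (g \o f).
Proof.
apply/continuousP => A oA.
exact: opensP (preim_opens (hom_cont f) (preim_opens (hom_cont g) (Opens oA))).
Qed.

(* The open sets (g o f)^-1 V and f^-1 (g^-1 V) agree only up to the proof     *)
(* that they are open; hence the identity restriction.                         *)
Definition comp_lrs_pull (V : opens Z) :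
    {rmorphism sect V -> sect (preim_opens comp_lrs_cont V)} :=
  @res X (preim_opens (hom_cont f) (preim_opens (hom_cont g) V))
       (preim_opens comp_lrs_cont V) (@subset_refl _ _)
  \o (hom_pull f (preim_opens (hom_cont g) V) \o hom_pull g V).

Lemma comp_lrs_pull_res (V W : opens Z) (h : W `<=` V)
    (h' : preim_opens comp_lrs_cont W `<=` preim_opens comp_lrs_cont V) s :
  comp_lrs_pull W (res h s) = res h' (comp_lrs_pull V s).
Proof.
rewrite /comp_lrs_pull /=.
have h1 : preim_opens (hom_cont g) W `<=` preim_opens (hom_cont g) V.
  by move=> y; apply: h.
have h2 : preim_opens (hom_cont f) (preim_opens (hom_cont g) W) `<=`
          preim_opens (hom_cont f) (preim_opens (hom_cont g) V).
  by move=> y; apply: h.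
rewrite (hom_pull_res g h h1) (hom_pull_res f h1 h2) !res_trans.
exact: res_irr.
Qed.

Lemma comp_lrs_local (V : opens Z) (s : sect V) x : V (g (f x)) ->
  germ_unit (comp_lrs_pull V s) x -> germ_unit s (g (f x)).
Proof.
move=> Vx /= /germ_unit_res H.
apply: (hom_local g Vx); apply: (hom_local f (Vx : preim_opens _ V (f x))).
exact: H.
Qed.

Definition comp_lrs : lrs_hom X Z := LrsHom comp_lrs_pull_res comp_lrs_local.

End LrsComp.
Arguments comp_lrs_cont {X Y Z} g f.

Section LrsCategory.

Lemma comp_lrs_id (X Y : lrs) (f : lrs_hom X Y) : comp_lrs f (id_lrs X) = f.
Proof.
apply: lrs_hom_ext => // V U hf hg s.
rewrite /= /comp_lrs_pull /= /id_lrs_pull !res_trans; exact: res_irr.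
Qed.

Lemma comp_lrsA (X Y Z W : lrs) (h : lrs_hom Z W) (g : lrs_hom Y Z)
    (f : lrs_hom X Y) :
  comp_lrs h (comp_lrs g f) = comp_lrs (comp_lrs h g) f.
Proof.
apply: lrs_hom_ext => // V U hf hg s.
have e : preim_opens (hom_cont f) (preim_opens (comp_lrs_cont h g) V) `<=`
  preim_opens (hom_cont f) (preim_opens (hom_cont g) (preim_opens (hom_cont h) V)).
  by [].
rewrite /= /comp_lrs_pull /= /comp_lrs_pull /= (hom_pull_res f _ e) !res_trans.
exact: res_irr.
Qed.

End LrsCategory.

Record spec (A : comPzRingType) := PrimeIdeal {
  prime_set :> set A;
  prime0 : prime_set 0;
  primeD : forall a b, prime_set a -> prime_set b -> prime_set (a + b);
  primeMl : forall r a, prime_set a -> prime_set (r * a);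
  prime1 : ~ prime_set 1;
  primeM : forall a b, prime_set (a * b) -> prime_set a \/ prime_set b }.

HB.instance Definition _ (A : comPzRingType) := gen_eqMixin (spec A).
HB.instance Definition _ (A : comPzRingType) := gen_choiceMixin (spec A).

Lemma spec_ext (A : comPzRingType) (p q : spec A) :
  (forall a, p a <-> q a) -> p = q.
Proof.
case: p => p p0 pD pM p1 pP; case: q => q q0 qD qM q1 qP /= pq.
have {pq} E : p = q by apply/funext => a; apply/propext.
by subst q; congr PrimeIdeal; exact: Prop_irrelevance.
Qed.

Section SpecTopology.
Variable A : comPzRingType.

Definition zariski_open (U : set (spec A)) : Prop :=
  exists E : set A, U = [set p : spec A | ~ E `<=` p].

Lemma not_subset_prime (E : set A) (p : spec A) :
  ~ E `<=` p <-> exists a, E a /\ ~ p a.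
Proof.
split=> [/existsNP[a /not_implyP[Ea pa]]|[a [Ea pa]] /(_ a Ea)//].
by exists a.
Qed.

Lemma zariski_openT : zariski_open setT.
Proof.
exists [set 1]; apply/seteqP; split=> // p _ /= /(_ 1 erefl); exact: prime1.
Qed.

Lemma zariski_openI : setI_closed zariski_open.
Proof.
move=> U V [E ->] [F ->].
exists [set c | exists a b, [/\ E a, F b & c = a * b]].
apply/seteqP; split=> p /=.
  move=> [/not_subset_prime[a [Ea pa]] /not_subset_prime[b [Fb pb]]].
  apply/not_subset_prime; exists (a * b); split; first by exists a, b.
  by move=> /primeM[].
move=> /not_subset_prime[_ [[a [b [Ea Fb ->]]] pab]].
split; apply/not_subset_prime.
- by exists a; split=> // pa; apply: pab; rewrite mulrC; apply: primeMl.
- by exists b; split=> // pb; apply: pab; apply: primeMl.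
Qed.

Lemma zariski_open_bigU (I : Type) (f : I -> set (spec A)) :
  (forall i, zariski_open (f i)) -> zariski_open (\bigcup_i f i).
Proof.
move=> /choice[E fE]; exists (\bigcup_i E i).
apply/seteqP; split=> p /=.
  move=> [i _]; rewrite fE => /not_subset_prime[a [Ea pa]].
  by apply/not_subset_prime; exists a; split=> //; exists i.
move=> /not_subset_prime[a [[i _ Ea] pa]]; exists i => //.
by rewrite fE; apply/not_subset_prime; exists a.
Qed.

HB.instance Definition _ := isOpenTopological.Build (spec A)
  zariski_openT zariski_openI zariski_open_bigU.

Lemma open_specE (U : set (spec A)) : open U <-> zariski_open U.
Proof. by []. Qed.

Lemma basic_open_subproof (a : A) : open [set p : spec A | ~ p a].
Proof.
apply/open_specE; exists [set a]; apply/seteqP; split=> p /=.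
  by move=> pa /(_ a erefl).
by move=> /not_subset_prime[_ [-> ]].
Qed.

Definition basic_open (a : A) : opens (spec A) := Opens (basic_open_subproof a).

End SpecTopology.

Section Localization.
Variables (A : comPzRingType) (p : spec A).

Record pre_frac := PreFrac { num : A; den : A; den_out : ~ p den }.
HB.instance Definition _ := gen_eqMixin pre_frac.
HB.instance Definition _ := gen_choiceMixin pre_frac.

Lemma primeN1 : ~ p 1. Proof. exact: prime1. Qed.

Lemma primeNM a b : ~ p a -> ~ p b -> ~ p (a * b).
Proof. by move=> pa pb /primeM[]. Qed.

Definition frac_eq (x y : pre_frac) : Prop :=
  exists u, ~ p u /\ u * (num x * den y) = u * (num y * den x).

Definition frac_eqb (x y : pre_frac) : bool := `[< frac_eq x y >].

Lemma frac_eqb_refl : reflexive frac_eqb.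
Proof. by move=> x; apply/asboolP; exists 1; split=> //; exact: primeN1. Qed.

Lemma frac_eqb_sym : symmetric frac_eqb.
Proof.
by move=> x y; apply/asboolP/asboolP => -[u [pu E]]; exists u; split.
Qed.

Lemma frac_eqb_trans : transitive frac_eqb.
Proof.
move=> y x z /asboolP[u [pu E]] /asboolP[v [pv F]]; apply/asboolP.
exists (u * v * den y); split.
  by do 2?[apply: primeNM => //]; exact: den_out.
transitivity (v * den z * (u * (num x * den y))); first by ring.
rewrite E; transitivity (u * den x * (v * (num y * den z))); first by ring.
by rewrite F; ring.
Qed.

Definition frac_equiv := EquivRel frac_eqb frac_eqb_refl frac_eqb_sym frac_eqb_trans.

Definition loc := {eq_quot frac_equiv}.
HB.instance Definition _ := Choice.on loc.

Definition mk_frac (a s : A) (ps : ~ p s) : loc := \pi_loc (PreFrac a ps).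

Lemma pi_frac_eq (x y : pre_frac) : \pi_loc x = \pi_loc y <-> frac_eq x y.
Proof.
by split=> [/eqmodP/asboolP|E]; last by apply/eqmodP/asboolP.
Qed.

Lemma mk_frac_eq a s (ps : ~ p s) b t (pt : ~ p t) :
  mk_frac a ps = mk_frac b pt <-> exists u, ~ p u /\ u * (a * t) = u * (b * s).
Proof. exact: pi_frac_eq. Qed.

Lemma locP (x : loc) : exists a s (ps : ~ p s), x = mk_frac a ps.
Proof.
by exists (num (repr x)), (den (repr x)), (@den_out (repr x));
   rewrite /mk_frac -[LHS]reprK; case: (repr x).
Qed.

Definition add_pre (x y : pre_frac) :=
  PreFrac (num x * den y + num y * den x) (primeNM (@den_out x) (@den_out y)).
Definition mul_pre (x y : pre_frac) :=
  PreFrac (num x * num y) (primeNM (@den_out x) (@den_out y)).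
Definition opp_pre (x : pre_frac) := PreFrac (- num x) (@den_out x).

Definition loc_zero : loc := mk_frac 0 primeN1.
Definition loc_one : loc := mk_frac 1 primeN1.
Definition loc_add (x y : loc) : loc := \pi_loc (add_pre (repr x) (repr y)).
Definition loc_mul (x y : loc) : loc := \pi_loc (mul_pre (repr x) (repr y)).
Definition loc_opp (x : loc) : loc := \pi_loc (opp_pre (repr x)).

Lemma repr_frac (x : pre_frac) : frac_eq (repr (\pi_loc x)) x.
Proof. by apply/pi_frac_eq; rewrite reprK. Qed.

Lemma loc_addE a s (ps : ~ p s) b t (pt : ~ p t) :
  loc_add (mk_frac a ps) (mk_frac b pt) =
  mk_frac (a * t + b * s) (primeNM ps pt).
Proof.
apply/pi_frac_eq.
have [u [pu /= E]] := repr_frac (PreFrac a ps).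
have [v [pv /= F]] := repr_frac (PreFrac b pt).
exists (u * v); split; first exact: primeNM.
move: E F; rewrite /mk_frac /=.
set x := repr _; set y := repr _ => E F.
transitivity (v * t * den y * (u * (num x * s)) +
              u * s * den x * (v * (num y * t))); first by ring.
by rewrite E F; ring.
Qed.

Lemma loc_mulE a s (ps : ~ p s) b t (pt : ~ p t) :
  loc_mul (mk_frac a ps) (mk_frac b pt) = mk_frac (a * b) (primeNM ps pt).
Proof.
apply/pi_frac_eq.
have [u [pu /= E]] := repr_frac (PreFrac a ps).
have [v [pv /= F]] := repr_frac (PreFrac b pt).
exists (u * v); split; first exact: primeNM.
move: E F; rewrite /mk_frac /=.
set x := repr _; set y := repr _ => E F.
transitivity ((u * (num x * s)) * (v * (num y * t))); first by ring.
by rewrite E F; ring.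
Qed.

Lemma loc_oppE a s (ps : ~ p s) : loc_opp (mk_frac a ps) = mk_frac (- a) ps.
Proof.
apply/pi_frac_eq.
have [u [pu /= E]] := repr_frac (PreFrac a ps).
exists u; split=> //=; move: E; rewrite /mk_frac /=; set x := repr _ => E.
by rewrite !mulNr !mulrN E.
Qed.

Lemma mk_frac_eqw a s (ps : ~ p s) b t (pt : ~ p t) :
  a * t = b * s -> mk_frac a ps = mk_frac b pt.
Proof. by move=> E; apply/mk_frac_eq; exists 1; rewrite E; split=> //; exact: primeN1. Qed.

Lemma loc_addA : associative loc_add.
Proof.
move=> x y z; have [a [s [ps ->]]] := locP x; have [b [t [pt ->]]] := locP y.
have [c [u [pu ->]]] := locP z; rewrite !loc_addE; apply: mk_frac_eqw; ring.
Qed.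

Lemma loc_addC : commutative loc_add.
Proof.
move=> x y; have [a [s [ps ->]]] := locP x; have [b [t [pt ->]]] := locP y.
rewrite !loc_addE; apply: mk_frac_eqw; ring.
Qed.

Lemma loc_add0 : left_id loc_zero loc_add.
Proof.
move=> x; have [a [s [ps ->]]] := locP x.
rewrite !loc_addE; apply: mk_frac_eqw; ring.
Qed.

Lemma loc_addN : left_inverse loc_zero loc_opp loc_add.
Proof.
move=> x; have [a [s [ps ->]]] := locP x.
rewrite loc_oppE loc_addE; apply: mk_frac_eqw; ring.
Qed.

Lemma loc_mulA : associative loc_mul.
Proof.
move=> x y z; have [a [s [ps ->]]] := locP x; have [b [t [pt ->]]] := locP y.
have [c [u [pu ->]]] := locP z; rewrite !loc_mulE; apply: mk_frac_eqw; ring.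
Qed.

Lemma loc_mulC : commutative loc_mul.
Proof.
move=> x y; have [a [s [ps ->]]] := locP x; have [b [t [pt ->]]] := locP y.
rewrite !loc_mulE; apply: mk_frac_eqw; ring.
Qed.

Lemma loc_mul1 : left_id loc_one loc_mul.
Proof.
move=> x; have [a [s [ps ->]]] := locP x.
rewrite !loc_mulE; apply: mk_frac_eqw; ring.
Qed.

Lemma loc_mulDl : left_distributive loc_mul loc_add.
Proof.
move=> x y z; have [a [s [ps ->]]] := locP x; have [b [t [pt ->]]] := locP y.
have [c [u [pu ->]]] := locP z; rewrite !(loc_mulE, loc_addE).
apply: mk_frac_eqw; ring.
Qed.

HB.instance Definition _ :=
  GRing.isZmodule.Build loc loc_addA loc_addC loc_add0 loc_addN.
HB.instance Definition _ :=
  GRing.Zmodule_isComPzRing.Build loc loc_mulA loc_mulC loc_mul1 loc_mulDl.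

Lemma mk_fracD a s (ps : ~ p s) b t (pt : ~ p t) :
  mk_frac a ps + mk_frac b pt = mk_frac (a * t + b * s) (primeNM ps pt).
Proof. exact: loc_addE. Qed.

Lemma mk_fracM a s (ps : ~ p s) b t (pt : ~ p t) :
  mk_frac a ps * mk_frac b pt = mk_frac (a * b) (primeNM ps pt).
Proof. exact: loc_mulE. Qed.

Lemma mk_fracN a s (ps : ~ p s) : - mk_frac a ps = mk_frac (- a) ps.
Proof. exact: loc_oppE. Qed.

Lemma mk_frac0 : mk_frac 0 primeN1 = 0. Proof. by []. Qed.
Lemma mk_frac1 : mk_frac 1 primeN1 = 1. Proof. by []. Qed.

Lemma frac_unitP a s (ps : ~ p s) :
  (exists x : loc, mk_frac a ps * x = 1) <-> ~ p a.
Proof.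
split=> [[x]|pa].
  have [b [t [pt ->]]] := locP x.
  rewrite mk_fracM -mk_frac1 => /mk_frac_eq[u [pu E]] pa.
  have : p (u * (1 * (s * t))).
    rewrite -E; apply: primeMl; rewrite mulr1 mulrC; exact: primeMl.
  by apply: primeNM => //; rewrite mul1r; exact: primeNM.
exists (mk_frac s pa); rewrite mk_fracM -mk_frac1; apply: mk_frac_eqw; ring.
Qed.

End Localization.

Section StructureSheaf.
Variable A : comPzRingType.

(* Sections over U of the structure sheaf of Spec A: the elements of           *)
(* \prod_(p in U) A_p that are locally given by fractions a / s.               *)
Record spec_sect (U : opens (spec A)) := SpecSect {
  sect_val :> forall p : spec A, U p -> loc p;
  sect_val_frac : forall p, U p -> exists V : opens (spec A), V p /\
    exists a s : A, forall q (Uq : U q), V q ->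
      exists qs : ~ q s, sect_val Uq = mk_frac a qs }.

HB.instance Definition _ (U : opens (spec A)) := gen_eqMixin (spec_sect U).
HB.instance Definition _ (U : opens (spec A)) := gen_choiceMixin (spec_sect U).

Lemma spec_sect_ext (U : opens (spec A)) (s t : spec_sect U) :
  (forall p (Up : U p), s p Up = t p Up) -> s = t.
Proof.
case: s => s sP; case: t => t tP /= E.
have {E} E : s = t.
  by do 2!(apply: functional_extensionality_dep => ?); exact: E.
by subst t; rewrite (Prop_irrelevance sP tP).
Qed.

Lemma sect_val_irr (U : opens (spec A)) (s : spec_sect U) p (h h' : U p) :
  s p h = s p h'.
Proof. by rewrite (Prop_irrelevance h h'). Qed.

Section Ring.
Variable U : opens (spec A).
Implicit Types f g h : spec_sect U.

Lemma ss_const_frac a s (Us : forall q, U q -> ~ q s) p (Up : U p) :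
  exists V : opens (spec A), V p /\ exists a' s' : A, forall q (Uq : U q),
    V q -> exists qs : ~ q s', mk_frac a (Us q Uq) = mk_frac a' qs.
Proof. by exists U; split=> //; exists a, s => q Uq _; exists (Us q Uq). Qed.

Definition ss_const a s (Us : forall q, U q -> ~ q s) : spec_sect U :=
  SpecSect (@ss_const_frac a s Us).

Lemma ss_add_frac f g p : U p ->
  exists V : opens (spec A), V p /\ exists a s : A, forall q (Uq : U q),
    V q -> exists qs : ~ q s, f q Uq + g q Uq = mk_frac a qs.
Proof.
move=> Up; have [V [Vp [a [s fE]]]] := sect_val_frac f Up.
have [W [Wp [b [t gE]]]] := sect_val_frac g Up.
exists (opensI V W); split=> //; exists (a * t + b * s), (s * t).
move=> q Uq [/(fE _ Uq)[qs ->] /(gE _ Uq)[qt ->]].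
by exists (primeNM qs qt); rewrite mk_fracD.
Qed.
Definition ss_add f g := SpecSect (@ss_add_frac f g).

Lemma ss_mul_frac f g p : U p ->
  exists V : opens (spec A), V p /\ exists a s : A, forall q (Uq : U q),
    V q -> exists qs : ~ q s, f q Uq * g q Uq = mk_frac a qs.
Proof.
move=> Up; have [V [Vp [a [s fE]]]] := sect_val_frac f Up.
have [W [Wp [b [t gE]]]] := sect_val_frac g Up.
exists (opensI V W); split=> //; exists (a * b), (s * t).
move=> q Uq [/(fE _ Uq)[qs ->] /(gE _ Uq)[qt ->]].
by exists (primeNM qs qt); rewrite mk_fracM.
Qed.
Definition ss_mul f g := SpecSect (@ss_mul_frac f g).

Lemma ss_opp_frac f p : U p ->
  exists V : opens (spec A), V p /\ exists a s : A, forall q (Uq : U q),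
    V q -> exists qs : ~ q s, - f q Uq = mk_frac a qs.
Proof.
move=> Up; have [V [Vp [a [s fE]]]] := sect_val_frac f Up.
exists V; split=> //; exists (- a), s => q Uq /(fE _ Uq)[qs ->].
by exists qs; rewrite mk_fracN.
Qed.
Definition ss_opp f := SpecSect (@ss_opp_frac f).

Definition ss_zero := @ss_const 0 1 (fun q _ => @primeN1 A q).
Definition ss_one := @ss_const 1 1 (fun q _ => @primeN1 A q).

Lemma ss_addA : associative ss_add.
Proof. by move=> f g h; apply: spec_sect_ext => p Up /=; rewrite addrA. Qed.
Lemma ss_addC : commutative ss_add.
Proof. by move=> f g; apply: spec_sect_ext => p Up /=; rewrite addrC. Qed.
Lemma ss_add0 : left_id ss_zero ss_add.
Proof. by move=> f; apply: spec_sect_ext => p Up /=; rewrite mk_frac0 add0r. Qed.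
Lemma ss_addN : left_inverse ss_zero ss_opp ss_add.
Proof. by move=> f; apply: spec_sect_ext => p Up /=; rewrite mk_frac0 addNr. Qed.
Lemma ss_mulA : associative ss_mul.
Proof. by move=> f g h; apply: spec_sect_ext => p Up /=; rewrite mulrA. Qed.
Lemma ss_mulC : commutative ss_mul.
Proof. by move=> f g; apply: spec_sect_ext => p Up /=; rewrite mulrC. Qed.
Lemma ss_mul1 : left_id ss_one ss_mul.
Proof. by move=> f; apply: spec_sect_ext => p Up /=; rewrite mk_frac1 mul1r. Qed.
Lemma ss_mulDl : left_distributive ss_mul ss_add.
Proof. by move=> f g h; apply: spec_sect_ext => p Up /=; rewrite mulrDl. Qed.

HB.instance Definition _ :=
  GRing.isZmodule.Build (spec_sect U) ss_addA ss_addC ss_add0 ss_addN.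
HB.instance Definition _ :=
  GRing.Zmodule_isComPzRing.Build (spec_sect U) ss_mulA ss_mulC ss_mul1 ss_mulDl.

End Ring.

Section Restriction.
Variables (U V : opens (spec A)) (VU : V `<=` U).

Lemma ss_res_frac (f : spec_sect U) p : V p ->
  exists W : opens (spec A), W p /\ exists a s : A, forall q (Vq : V q),
    W q -> exists qs : ~ q s, f q (VU Vq) = mk_frac a qs.
Proof.
move=> /VU Up; have [W [Wp [a [s fE]]]] := sect_val_frac f Up.
by exists W; split=> //; exists a, s => q Vq Wq; apply: fE.
Qed.

Definition ss_res_fun (f : spec_sect U) := SpecSect (@ss_res_frac f).

Lemma ss_res_funD : {morph ss_res_fun : f g / f + g}.
Proof. by move=> f g; apply: spec_sect_ext. Qed.
Lemma ss_res_fun1 : ss_res_fun 1 = 1.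
Proof. exact: spec_sect_ext. Qed.
Lemma ss_res_funM : {morph ss_res_fun : f g / f * g}.
Proof. by move=> f g; apply: spec_sect_ext. Qed.

Definition ss_res : {rmorphism spec_sect U -> spec_sect V} :=
  mk_rmorphism ss_res_funD ss_res_fun1 ss_res_funM.

End Restriction.

Lemma ss_res_id (U : opens (spec A)) (h : U `<=` U) (f : spec_sect U) :
  ss_res h f = f.
Proof. by apply: spec_sect_ext => p Up /=; exact: sect_val_irr. Qed.

Lemma ss_res_comp (U V W : opens (spec A)) (hV : V `<=` U) (hW : W `<=` V)
    (h : W `<=` U) (f : spec_sect U) :
  ss_res hW (ss_res hV f) = ss_res h f.
Proof.
by apply: spec_sect_ext => p Wp /=; exact: sect_val_irr.
Qed.

Definition spec_rs : ringed_space := RingedSpace ss_res_id ss_res_comp.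

Lemma spec_sheaf : is_sheaf spec_rs.
Proof.
move=> I U V VU cov; split=> [s t st|s sE].
  apply: spec_sect_ext => p Up; have [i _ Vp] := cov p Up.
  have /(congr1 (fun f : spec_sect (V i) => f p Vp)) /= := st i.
  by rewrite !(sect_val_irr _ _ Up).
have {sE} sE i j p (Vi : V i p) (Vj : V j p) :
    (s i : spec_sect _) p Vi = (s j : spec_sect _) p Vj.
  have hi : opensI (V i) (V j) `<=` V i by move=> q [].
  have hj : opensI (V i) (V j) `<=` V j by move=> q [].
  have /(congr1 (fun f : spec_sect (opensI (V i) (V j)) => f p (conj Vi Vj))) :=
    sE i j _ hi hj.
  by rewrite /= (sect_val_irr _ _ Vi) (sect_val_irr _ _ Vj).
have cov' p (Up : U p) : exists i, V i p.
  by have [i _ Vp] := cov p Up; exists i.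
pose t p (Up : U p) : loc p :=
  (s (projT1 (cid (cov' p Up))) : spec_sect _) p (projT2 (cid (cov' p Up))).
have tE i p (Up : U p) (Vp : V i p) : t p Up = (s i : spec_sect _) p Vp.
  exact: sE.
have tP p : U p -> exists W : opens (spec A), W p /\
    exists a s : A, forall q (Uq : U q), W q ->
      exists qs : ~ q s, t q Uq = mk_frac a qs.
  move=> Up; have [i Vp] := cov' p Up.
  have [W [Wp [a [u sW]]]] := sect_val_frac (s i : spec_sect _) Vp.
  exists (opensI (V i) W); split=> //; exists a, u => q Uq [Vq Wq].
  by rewrite (tE i q Uq Vq); apply: sW.
by exists (SpecSect tP) => i; apply: spec_sect_ext => p Vp /=; apply: tE.
Qed.

Lemma spec_germ_unit (U : opens (spec A)) (f : spec_sect U) p (Up : U p) :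
  @germ_unit spec_rs U f p <-> exists x : loc p, f p Up * x = 1.
Proof.
split=> [[V [h [Vp [t ft]]]]|[x fx]].
  exists ((t : spec_sect V) p Vp).
  have /(congr1 (fun f : spec_sect V => f p Vp)) /= := ft.
  by rewrite (sect_val_irr _ _ Up) => ->.
have [V [Vp [a [s fE]]]] := sect_val_frac f Up.
have [ps fpE] := fE p Up Vp.
have /frac_unitP pa : exists x, mk_frac a ps * x = 1 by exists x; rewrite -fpE.
pose W := opensI (opensI U V) (basic_open a).
have WU : W `<=` U by move=> q [[]].
have Wa q : W q -> ~ q a by case.
exists W, WU; split=> //; exists (ss_const s Wa).
apply: spec_sect_ext => q Wq /=.
have Vq : V q by case: Wq => -[].
have [qs ->] := fE q (WU q Wq) Vq.
by rewrite mk_fracM; apply: mk_frac_eqw; ring.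
Qed.

Lemma spec_local : has_local_stalks spec_rs.
Proof.
move=> U p Up; split=> [/(spec_germ_unit _ Up)[x]|s t].
  rewrite -[X in X * _]/(mk_frac 0 (@primeN1 A p)) => E.
  have /frac_unitP : exists x, mk_frac 0 (@primeN1 A p) * x = 1 by exists x.
  by apply; apply: prime0.
move=> /(spec_germ_unit _ Up) H; move: H.
rewrite -[(s + t) p Up]/((s : spec_sect U) p Up + (t : spec_sect U) p Up).
have [a [u [pu sE]]] := locP ((s : spec_sect U) p Up).
have [b [v [pv tE]]] := locP ((t : spec_sect U) p Up).
rewrite sE tE mk_fracD => /frac_unitP pab.
have [pa|/contrapT pa] := EM (~ p a).
  by left; apply/(spec_germ_unit _ Up); rewrite sE; apply/frac_unitP.
right; apply/(spec_germ_unit _ Up); rewrite tE; apply/frac_unitP => pb.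
by apply: pab; apply: primeD; rewrite mulrC; apply: primeMl.
Qed.

Definition Spec : lrs := Lrs spec_sheaf spec_local.

End StructureSheaf.

Section SpecMap.
Variables (A B : comPzRingType) (phi : {rmorphism A -> B}).

Section Comap.
Variable q : spec B.

Lemma comap0 : (phi @^-1` q) 0.
Proof. by rewrite /preimage /= rmorph0; exact: prime0. Qed.
Lemma comapD a b :
  (phi @^-1` q) a -> (phi @^-1` q) b -> (phi @^-1` q) (a + b).
Proof. by rewrite /preimage /= rmorphD; exact: primeD. Qed.
Lemma comapMl r a : (phi @^-1` q) a -> (phi @^-1` q) (r * a).
Proof. by rewrite /preimage /= rmorphM; exact: primeMl. Qed.
Lemma comap1 : ~ (phi @^-1` q) 1.
Proof. by rewrite /preimage /= rmorph1; exact: prime1. Qed.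
Lemma comapM a b : (phi @^-1` q) (a * b) ->
  (phi @^-1` q) a \/ (phi @^-1` q) b.
Proof. by rewrite /preimage /= rmorphM => /primeM. Qed.

Definition comap : spec A := PrimeIdeal comap0 comapD comapMl comap1 comapM.

Definition loc_map_fun (x : loc comap) : loc q :=
  @mk_frac B q (phi (num (repr x))) (phi (den (repr x))) (@den_out _ _ (repr x)).

Lemma loc_map_funE a s (ps : ~ comap s) :
  loc_map_fun (mk_frac a ps) = @mk_frac B q (phi a) (phi s) ps.
Proof.
have [u [pu /= E]] := repr_frac (PreFrac a ps).
apply/mk_frac_eq; exists (phi u); split=> //.
by rewrite -!rmorphM; congr (phi _).
Qed.

Lemma loc_map_funD : {morph loc_map_fun : x y / x + y}.
Proof.
move=> x y; have [a [s [ps ->]]] := locP x; have [b [t [pt ->]]] := locP y.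
rewrite mk_fracD !loc_map_funE mk_fracD; apply: mk_frac_eqw.
by rewrite rmorphD !rmorphM.
Qed.

Lemma loc_map_fun1 : loc_map_fun 1 = 1.
Proof.
rewrite -mk_frac1 loc_map_funE -mk_frac1; apply: mk_frac_eqw.
by rewrite rmorph1.
Qed.

Lemma loc_map_funM : {morph loc_map_fun : x y / x * y}.
Proof.
move=> x y; have [a [s [ps ->]]] := locP x; have [b [t [pt ->]]] := locP y.
rewrite mk_fracM !loc_map_funE mk_fracM; apply: mk_frac_eqw.
by rewrite !rmorphM.
Qed.

Definition loc_map : {rmorphism loc comap -> loc q} :=
  mk_rmorphism loc_map_funD loc_map_fun1 loc_map_funM.

End Comap.

Lemma comap_cont : continuous comap.
Proof.
apply/continuousP => U /open_specE[E ->]; apply/open_specE.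
exists (phi @` E); apply/seteqP; split=> q Hq.
  have /not_subset_prime[a [Ea qa]] : ~ E `<=` comap q := Hq.
  by apply/not_subset_prime; exists (phi a); split=> //; exists a.
have /not_subset_prime[_ [[a Ea <-] qa]] := Hq.
suff: ~ E `<=` comap q by [].
by apply/not_subset_prime; exists a.
Qed.

Section Pull.
Variable V : opens (spec A).

Lemma ss_pull_frac (f : spec_sect V) q : preim_opens comap_cont V q ->
  exists W : opens (spec B), W q /\ exists b t : B,
    forall r (Vr : preim_opens comap_cont V r), W r ->
      exists rt : ~ r t, loc_map r (f (comap r) Vr) = mk_frac b rt.
Proof.
move=> Vq; have [W [Wq [a [s fE]]]] := sect_val_frac f Vq.
exists (preim_opens comap_cont W); split=> //; exists (phi a), (phi s).
move=> r Vr Wr; have [rs ->] := fE _ Vr Wr.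
by exists rs; rewrite -[LHS]/(loc_map_fun _) loc_map_funE.
Qed.

Definition ss_pull_fun (f : spec_sect V) : spec_sect (preim_opens comap_cont V) :=
  SpecSect (@ss_pull_frac f).

Lemma ss_pull_funD : {morph ss_pull_fun : f g / f + g}.
Proof. by move=> f g; apply: spec_sect_ext => q Vq; exact: (rmorphD (loc_map q)). Qed.
Lemma ss_pull_fun1 : ss_pull_fun 1 = 1.
Proof. by apply: spec_sect_ext => q Vq; exact: (rmorph1 (loc_map q)). Qed.
Lemma ss_pull_funM : {morph ss_pull_fun : f g / f * g}.
Proof. by move=> f g; apply: spec_sect_ext => q Vq; exact: (rmorphM (loc_map q)). Qed.

Definition ss_pull :
    {rmorphism spec_sect V -> spec_sect (preim_opens comap_cont V)} :=
  mk_rmorphism ss_pull_funD ss_pull_fun1 ss_pull_funM.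

End Pull.

Lemma ss_pull_res (V W : opens (spec A)) (h : W `<=` V)
    (h' : preim_opens comap_cont W `<=` preim_opens comap_cont V)
    (f : spec_sect V) :
  ss_pull W (ss_res h f) = ss_res h' (ss_pull V f).
Proof.
apply: spec_sect_ext => q Wq /=.
by congr (loc_map_fun _); exact: sect_val_irr.
Qed.

Lemma ss_pull_local (V : opens (spec A)) (f : spec_sect V) (q : spec B) :
  V (comap q) -> @germ_unit (Spec B) _ (ss_pull V f) q ->
  @germ_unit (Spec A) _ f (comap q).
Proof.
move=> Vq /(@spec_germ_unit _ _ _ _ (Vq : preim_opens comap_cont V q)) H.
apply/(spec_germ_unit _ Vq); move: H => /=.
have [a [s [qs ->]]] := locP (f (comap q) Vq).
by rewrite loc_map_funE => /frac_unitP H; apply/frac_unitP.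
Qed.

Definition Spec_map : lrs_hom (Spec B) (Spec A) :=
  @LrsHom (Spec B) (Spec A) comap comap_cont ss_pull ss_pull_res ss_pull_local.

End SpecMap.

Lemma sect_val_transport (A : comPzRingType) (U : opens (spec A))
    (f : spec_sect U) (p p' : spec A) (Up : U p) (Up' : U p') a s
    (ps : ~ p s) (ps' : ~ p' s) :
  p = p' -> f p Up = mk_frac a ps -> f p' Up' = mk_frac a ps'.
Proof.
move=> e; subst p'; rewrite (sect_val_irr _ Up' Up) => ->.
exact: mk_frac_eqw.
Qed.

Arguments sect_val_transport {A U f p p' Up} Up' {a s ps} ps' _ _.

Lemma Spec_map_id (A : comPzRingType) :
  Spec_map (idfun : {rmorphism A -> A}) = id_lrs (Spec A).
Proof.
have E (p : spec A) : comap (idfun : {rmorphism A -> A}) p = p.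
  exact: spec_ext.
apply: lrs_hom_ext => [p|V U hf hg s]; first exact: E.
apply: spec_sect_ext => p Up /=.
set Vf := hf p Up; set Vg := subset_refl _.
have [a [u [pu sE]]] := locP ((s : spec_sect V) _ Vf).
rewrite sE loc_map_funE; apply/esym.
exact: (sect_val_transport _ _ (E p) sE).
Qed.

Lemma Spec_map_comp (A B C : comPzRingType) (phi : {rmorphism A -> B})
    (psi : {rmorphism B -> C}) :
  Spec_map (psi \o phi : {rmorphism A -> C}) =
  comp_lrs (Spec_map phi) (Spec_map psi).
Proof.
have E (p : spec C) :
    comap (psi \o phi : {rmorphism A -> C}) p = comap phi (comap psi p).
  exact: spec_ext.
apply: lrs_hom_ext => [p|V U hf hg s]; first exact: E.
apply: spec_sect_ext => p Up /=.
set Vf := hf p Up; set Vg := subset_refl _.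
have [a [u [pu sE]]] := locP ((s : spec_sect V) _ Vf).
have pu' : ~ comap phi (comap psi p) u by rewrite -E.
rewrite sE (sect_val_transport Vg pu' (E p) sE) (@loc_map_funE _ _ phi _ _ _ pu') !loc_map_funE.
exact: mk_frac_eqw.
Qed.

(* j induces an isomorphism of X onto the open subspace j(X) of Y. *)
Definition open_immersion (X Y : lrs) (j : lrs_hom X Y) : Prop :=
  [/\ injective j,
      forall U : opens X, open (j @` U) &
      forall V : opens Y, V `<=` range j -> bijective (hom_pull j V)].

Definition lrs_isomorphic (X Y : lrs) : Prop :=
  exists (f : lrs_hom X Y) (g : lrs_hom Y X),
    comp_lrs g f = id_lrs X /\ comp_lrs f g = id_lrs Y.

Record scheme := Scheme {
  sch_lrs :> lrs;
  sch_cover : forall x : sch_lrs, exists (A : comPzRingType)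
    (j : lrs_hom (Spec A) sch_lrs), open_immersion j /\ range j x }.

Definition is_affine (X : scheme) : Prop :=
  exists A : comPzRingType, lrs_isomorphic X (Spec A).

Lemma id_open_immersion (X : lrs) : open_immersion (id_lrs X).
Proof.
split=> [x y //|U|V _]; first by rewrite image_id; exact: opensP.
exists (@res X (preim_opens (@id_lrs_cont X) V) V (@subset_refl _ _)) => s;
  by rewrite /= /id_lrs_pull res_trans res_id.
Qed.

Lemma Spec_cover (A : comPzRingType) (x : Spec A) : exists (B : comPzRingType)
  (j : lrs_hom (Spec B) (Spec A)), open_immersion j /\ range j x.
Proof.
exists A, (id_lrs (Spec A)); split; first exact: id_open_immersion.
by exists x.
Qed.

Definition SpecSch (A : comPzRingType) : scheme := Scheme (@Spec_cover A).

Record rscheme (R : comPzRingType) := RScheme {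
  rsch :> scheme;
  rsch_str : lrs_hom rsch (Spec R) }.

Record rsch_hom (R : comPzRingType) (X Y : rscheme R) := RSchHom {
  rsch_hom_lrs :> lrs_hom X Y;
  rsch_homP : comp_lrs (rsch_str Y) rsch_hom_lrs = rsch_str X }.

Lemma rsch_hom_ext (R : comPzRingType) (X Y : rscheme R) (f g : rsch_hom X Y) :
  rsch_hom_lrs f = rsch_hom_lrs g -> f = g.
Proof.
case: f => f fP; case: g => g gP /= fg; subst g.
by rewrite (Prop_irrelevance fP gP).
Qed.

Lemma comp_rsch_subproof (R : comPzRingType) (X Y Z : rscheme R)
    (g : rsch_hom Y Z) (f : rsch_hom X Y) :
  comp_lrs (rsch_str Z) (comp_lrs g f) = rsch_str X.
Proof. by rewrite comp_lrsA !rsch_homP. Qed.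

Definition comp_rsch (R : comPzRingType) (X Y Z : rscheme R)
    (g : rsch_hom Y Z) (f : rsch_hom X Y) : rsch_hom X Z :=
  RSchHom (comp_rsch_subproof g f).

(* Not [comAlgType R], which excludes the zero algebra. *)
Record algebra (R : comPzRingType) := Algebra {
  alg_ring :> comPzRingType;
  alg_map : {rmorphism R -> alg_ring} }.

Record alg_hom (R : comPzRingType) (S T : algebra R) := AlgHom {
  alg_hom_fun :> {rmorphism S -> T};
  alg_homP : forall r, alg_hom_fun (alg_map S r) = alg_map T r }.

Lemma alg_hom_ext (R : comPzRingType) (S T : algebra R) (f g : alg_hom S T) :
  f =1 g -> f = g.
Proof.
case: f => f fP; case: g => g gP /= /rmorphism_ext fg; subst g.
by rewrite (Prop_irrelevance fP gP).
Qed.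

Definition alg_id (R : comPzRingType) (S : algebra R) : alg_hom S S :=
  @AlgHom R S S idfun (fun r => erefl).

Lemma alg_comp_subproof (R : comPzRingType) (S T U : algebra R)
    (g : alg_hom T U) (f : alg_hom S T) r :
  (g \o f) (alg_map S r) = alg_map U r.
Proof. by rewrite /= !alg_homP. Qed.

Definition alg_comp (R : comPzRingType) (S T U : algebra R)
    (g : alg_hom T U) (f : alg_hom S T) : alg_hom S U :=
  @AlgHom R S U (g \o f) (alg_comp_subproof g f).

Definition SpecAlg (R : comPzRingType) (S : algebra R) : rscheme R :=
  @RScheme R (SpecSch S) (Spec_map (alg_map S)).

Lemma SpecAlg_map_subproof (R : comPzRingType) (S T : algebra R)
    (f : alg_hom S T) :
  comp_lrs (rsch_str (SpecAlg S)) (Spec_map f) = rsch_str (SpecAlg T).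
Proof.
rewrite /= -Spec_map_comp; congr Spec_map; apply: rmorphism_ext => r /=.
exact: alg_homP.
Qed.

Definition SpecAlg_map (R : comPzRingType) (S T : algebra R)
    (f : alg_hom S T) : rsch_hom (SpecAlg T) (SpecAlg S) :=
  @RSchHom R (SpecAlg T) (SpecAlg S) (Spec_map f) (SpecAlg_map_subproof f).

(* An S-algebra viewed as an R-algebra *)
Definition alg_restr (R : comPzRingType) (S : algebra R) (T : algebra S) :
    algebra R :=
  @Algebra R T (alg_map T \o alg_map S).

Definition alg_restr_hom (R : comPzRingType) (S : algebra R) (T T' : algebra S)
    (f : alg_hom T T') : alg_hom (alg_restr T) (alg_restr T') :=
  @AlgHom R (alg_restr T) (alg_restr T') f (fun r => alg_homP f _).

Definition alg_self (R : comPzRingType) : algebra R := @Algebra R R idfun.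

(* A T-algebra viewed as an S-algebra through f *)
Definition alg_pull (R : comPzRingType) (S T : algebra R) (f : alg_hom S T)
    (U : algebra T) : algebra S :=
  @Algebra S U (alg_map U \o f).

Definition alg_pull_hom (R : comPzRingType) (S T : algebra R) (f : alg_hom S T)
    (U U' : algebra T) (g : alg_hom U U') :
    alg_hom (alg_pull f U) (alg_pull f U') :=
  @AlgHom S (alg_pull f U) (alg_pull f U') g (fun r => alg_homP g _).

(* The identity of U, seen as a morphism between two R-algebra structures on U *)
(* which are equal, but not definitionally.                                    *)
Lemma alg_pull_iso_subproof (R : comPzRingType) (S T : algebra R)
    (f : alg_hom S T) (U : algebra T) (r : R) :
  alg_map (alg_restr U) r = alg_map (alg_restr (alg_pull f U)) r.
Proof. by rewrite /= alg_homP. Qed.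

Definition alg_pull_iso (R : comPzRingType) (S T : algebra R)
    (f : alg_hom S T) (U : algebra T) :
    alg_hom (alg_restr U) (alg_restr (alg_pull f U)) :=
  @AlgHom R (alg_restr U) (alg_restr (alg_pull f U)) idfun
    (alg_pull_iso_subproof f U).

(* The structure morphism S -> T of an S-algebra T, as a morphism to T seen as *)
(* an R-algebra and then as an algebra over itself.                            *)
Definition alg_str_hom (R : comPzRingType) (S : algebra R) (T : algebra S) :
    alg_hom S (alg_restr (alg_self (alg_restr T))) :=
  @AlgHom R S (alg_restr (alg_self (alg_restr T))) (alg_map T) (fun r => erefl).

(* The values are in [Type] rather than in the library's structures because    *)
(* Hom_R(M, R) ranges over all R-algebras and so lives in a larger universe.   *)
Record functor (R : comPzRingType) := Functor {
  fobj :> algebra R -> Type;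
  fmap : forall S T : algebra R, alg_hom S T -> fobj S -> fobj T;
  fmap_id : forall (S : algebra R) (x : fobj S), fmap (alg_id S) x = x;
  fmap_comp : forall (S T U : algebra R) (g : alg_hom T U) (f : alg_hom S T)
    (x : fobj S), fmap (alg_comp g f) x = fmap g (fmap f x) }.

Record module_structure (R : comPzRingType) (F : functor R) := ModuleStructure {
  mzero : forall S : algebra R, F S;
  madd : forall S : algebra R, F S -> F S -> F S;
  mopp : forall S : algebra R, F S -> F S;
  mscale : forall S : algebra R, S -> F S -> F S;
  maddA : forall S : algebra R, associative (@madd S);
  maddC : forall S : algebra R, commutative (@madd S);
  madd0 : forall S : algebra R, left_id (mzero S) (@madd S);
  maddN : forall S : algebra R, left_inverse (mzero S) (@mopp S) (@madd S);
  mscaleA : forall (S : algebra R) (a b : S) (x : F S),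
    mscale a (mscale b x) = mscale (a * b) x;
  mscale1 : forall (S : algebra R) (x : F S), mscale 1 x = x;
  mscaleDr : forall (S : algebra R) (a : S) (x y : F S),
    mscale a (madd x y) = madd (mscale a x) (mscale a y);
  mscaleDl : forall (S : algebra R) (a b : S) (x : F S),
    mscale (a + b) x = madd (mscale a x) (mscale b x);
  fmap_madd : forall (S T : algebra R) (f : alg_hom S T) (x y : F S),
    fmap f (madd x y) = madd (fmap f x) (fmap f y);
  fmap_mscale : forall (S T : algebra R) (f : alg_hom S T) (a : S) (x : F S),
    fmap f (mscale a x) = mscale (f a) (fmap f x) }.

Record rmodule (R : comPzRingType) := RModule {
  rmod_functor :> functor R;
  rmod_str : module_structure rmod_functor }.

Definition radd (R : comPzRingType) (M : rmodule R) (S : algebra R) :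
  M S -> M S -> M S := madd (rmod_str M) (S := S).
Definition rscale (R : comPzRingType) (M : rmodule R) (S : algebra R) :
  S -> M S -> M S := mscale (rmod_str M) (S := S).

Record rmod_hom (R : comPzRingType) (M N : rmodule R) := RModHom {
  rmod_hom_fun :> forall S : algebra R, M S -> N S;
  rmod_hom_nat : forall (S T : algebra R) (f : alg_hom S T) (x : M S),
    rmod_hom_fun (fmap f x) = fmap f (rmod_hom_fun x);
  rmod_homD : forall (S : algebra R) (x y : M S),
    rmod_hom_fun (radd x y) = radd (rmod_hom_fun x) (rmod_hom_fun y);
  rmod_homZ : forall (S : algebra R) (a : S) (x : M S),
    rmod_hom_fun (rscale a x) = rscale a (rmod_hom_fun x) }.

Lemma rmod_hom_ext (R : comPzRingType) (M N : rmodule R) (f g : rmod_hom M N) :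
  (forall S x, f S x = g S x) -> f = g.
Proof.
case: f => f f1 f2 f3; case: g => g g1 g2 g3 /= fg.
have {fg} E : f = g by do 2!(apply: functional_extensionality_dep => ?).
by subst g; congr RModHom; exact: Prop_irrelevance.
Qed.

Lemma rmod_hom_arg (R : comPzRingType) (M N : rmodule R) (f : rmod_hom M N)
    (S : algebra R) (x y : M S) : x = y -> f S x = f S y.
Proof. by move=> ->. Qed.
Arguments rmod_hom_arg {R M N} f S {x y} _.

Definition rmod_iso (R : comPzRingType) (M N : rmodule R) (f : rmod_hom M N) :=
  exists g : rmod_hom N M, forall S : algebra R,
    cancel (f S) (g S) /\ cancel (g S) (f S).

Definition rmod_isomorphic (R : comPzRingType) (M N : rmodule R) : Prop :=
  exists f : rmod_hom M N, rmod_iso f.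

Lemma fmap_ext (R : comPzRingType) (F : functor R) (S T : algebra R)
    (f g : alg_hom S T) (x : F S) : f =1 g -> fmap f x = fmap g x.
Proof. by move=> /alg_hom_ext ->. Qed.

Section RingFunctor.
Variable R : comPzRingType.

Definition ring_functor : functor R :=
  @Functor R (fun S => S) (fun S T f => f)
    (fun S x => erefl) (fun S T U g f x => erefl).

Definition ring_module_structure : module_structure ring_functor :=
  @ModuleStructure R ring_functor
    (fun S => 0) (fun S => +%R) (fun S => -%R) (fun S => *%R)
    (fun S => @addrA S) (fun S => @addrC S) (fun S => @add0r S)
    (fun S => @addNr S) (fun S => @mulrA S) (fun S => @mul1r S)
    (fun S => @mulrDr S) (fun S => @mulrDl S)
    (fun S T f => rmorphD f) (fun S T f => rmorphM f).

Definition ring_rmodule : rmodule R := RModule ring_module_structure.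

End RingFunctor.

Section Restriction.
Variables (R : comPzRingType) (M : rmodule R) (S : algebra R).

Lemma restr_fmap_id (T : algebra S) (x : M (alg_restr T)) :
  fmap (alg_restr_hom (alg_id T)) x = x.
Proof. by rewrite -[RHS]fmap_id; exact: fmap_ext. Qed.

Lemma restr_fmap_comp (T U V : algebra S) (g : alg_hom U V) (f : alg_hom T U)
    (x : M (alg_restr T)) :
  fmap (alg_restr_hom (alg_comp g f)) x =
  fmap (alg_restr_hom g) (fmap (alg_restr_hom f) x).
Proof. by rewrite -fmap_comp; exact: fmap_ext. Qed.

Definition restr_functor : functor S :=
  @Functor S (fun T => M (alg_restr T))
    (fun T U f => fmap (alg_restr_hom f)) restr_fmap_id restr_fmap_comp.

Definition restr_structure : module_structure restr_functor :=
  @ModuleStructure S restr_functor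
    (fun T => mzero (rmod_str M) (alg_restr T))
    (fun T => @madd _ _ (rmod_str M) (alg_restr T))
    (fun T => @mopp _ _ (rmod_str M) (alg_restr T))
    (fun T => @mscale _ _ (rmod_str M) (alg_restr T))
    (fun T => @maddA _ _ (rmod_str M) (alg_restr T))
    (fun T => @maddC _ _ (rmod_str M) (alg_restr T))
    (fun T => @madd0 _ _ (rmod_str M) (alg_restr T))
    (fun T => @maddN _ _ (rmod_str M) (alg_restr T))
    (fun T => @mscaleA _ _ (rmod_str M) (alg_restr T))
    (fun T => @mscale1 _ _ (rmod_str M) (alg_restr T))
    (fun T => @mscaleDr _ _ (rmod_str M) (alg_restr T))
    (fun T => @mscaleDl _ _ (rmod_str M) (alg_restr T))
    (fun T U f => @fmap_madd _ _ (rmod_str M) _ _ (alg_restr_hom f))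
    (fun T U f => @fmap_mscale _ _ (rmod_str M) _ _ (alg_restr_hom f)).

(* M_|S, where M_|S (T) is M at T seen as an R-algebra *)
Definition restr : rmodule S := RModule restr_structure.

End Restriction.

Section Dual.
Variables (R : comPzRingType) (M : rmodule R).

Definition dual_obj (S : algebra R) : Type :=
  rmod_hom (restr M S) (ring_rmodule S).

Section Map.
Variables (S T : algebra R) (f : alg_hom S T) (phi : dual_obj S).

Definition dual_map_fun (U : algebra T) (x : restr M T U) : ring_rmodule T U :=
  phi (alg_pull f U) (fmap (alg_pull_iso f U) x).

Lemma dual_map_nat (U V : algebra T) (g : alg_hom U V) (x : restr M T U) :
  dual_map_fun (fmap g x) = fmap g (dual_map_fun x).
Proof.
have := rmod_hom_nat phi (alg_pull_hom f g) (fmap (alg_pull_iso f U) x).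
rewrite /dual_map_fun /= => <-; refine (rmod_hom_arg phi (alg_pull f V) _).
by rewrite /= -!fmap_comp; exact: fmap_ext.
Qed.

Lemma dual_mapD (U : algebra T) (x y : restr M T U) :
  dual_map_fun (radd x y) = radd (dual_map_fun x) (dual_map_fun y).
Proof.
rewrite -[RHS](@rmod_homD _ _ _ phi (alg_pull f U)); refine (rmod_hom_arg phi (alg_pull f U) _).
exact: (fmap_madd (rmod_str M) (alg_pull_iso f U) x y).
Qed.

Lemma dual_mapZ (U : algebra T) (a : U) (x : restr M T U) :
  dual_map_fun (rscale a x) = rscale a (dual_map_fun x).
Proof.
rewrite -[RHS](@rmod_homZ _ _ _ phi (alg_pull f U)); refine (rmod_hom_arg phi (alg_pull f U) _).
exact: (fmap_mscale (rmod_str M) (alg_pull_iso f U) a x).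
Qed.

Definition dual_map : dual_obj T := RModHom dual_map_nat dual_mapD dual_mapZ.

End Map.

Lemma dual_map_id (S : algebra R) (phi : dual_obj S) :
  dual_map (alg_id S) phi = phi.
Proof.
apply: rmod_hom_ext => U x. rewrite /= /dual_map_fun.
pose i : alg_hom (alg_pull (alg_id S) U) U :=
  @AlgHom S (alg_pull (alg_id S) U) U idfun (fun r => erefl).
have := rmod_hom_nat phi i (fmap (alg_pull_iso (alg_id S) U) x).
rewrite [X in _ = X]/= => <-; refine (rmod_hom_arg phi U _).
by rewrite /= -fmap_comp -[RHS]fmap_id; exact: fmap_ext.
Qed.

Lemma dual_map_comp (S T U : algebra R) (g : alg_hom T U) (f : alg_hom S T)
    (phi : dual_obj S) :
  dual_map (alg_comp g f) phi = dual_map g (dual_map f phi).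
Proof.
apply: rmod_hom_ext => V x. rewrite /= /dual_map_fun.
pose i : alg_hom (alg_pull (alg_comp g f) V) (alg_pull f (alg_pull g V)) :=
  @AlgHom S (alg_pull (alg_comp g f) V) (alg_pull f (alg_pull g V)) idfun
    (fun r => erefl).
have := rmod_hom_nat phi i (fmap (alg_pull_iso (alg_comp g f) V) x).
rewrite [X in _ = X]/= => <-; refine (rmod_hom_arg phi (alg_pull f (alg_pull g V)) _).
by rewrite /= -!fmap_comp; exact: fmap_ext.
Qed.

Definition dual_functor : functor R :=
  @Functor R dual_obj dual_map dual_map_id dual_map_comp.

Section Operations.
Variable S : algebra R.
Implicit Types phi psi : dual_obj S.

Definition dual_zero : dual_obj S.
Proof.
apply: (@RModHom S (restr M S) (ring_rmodule S) (fun T _ => 0 : T)).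
- by move=> T U f x; rewrite /= rmorph0.
- by move=> T x y; rewrite /radd /= addr0.
- by move=> T a x; rewrite /rscale /= mulr0.
Defined.

Definition dual_add phi psi : dual_obj S.
Proof.
apply: (@RModHom S (restr M S) (ring_rmodule S)
  (fun T x => (phi T x : T) + psi T x)).
- by move=> T U f x; rewrite !rmod_hom_nat /= rmorphD.
- by move=> T x y; rewrite !rmod_homD /radd /= addrACA.
- by move=> T a x; rewrite !rmod_homZ /rscale /= mulrDr.
Defined.

Definition dual_opp phi : dual_obj S.
Proof.
apply: (@RModHom S (restr M S) (ring_rmodule S) (fun T x => - (phi T x : T))).
- by move=> T U f x; rewrite !rmod_hom_nat /= rmorphN.
- by move=> T x y; rewrite !rmod_homD /radd /= opprD.
- by move=> T a x; rewrite !rmod_homZ /rscale /= mulrN.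
Defined.

Definition dual_scale (s : S) phi : dual_obj S.
Proof.
apply: (@RModHom S (restr M S) (ring_rmodule S)
  (fun T x => alg_map T s * phi T x)).
- by move=> T U f x; rewrite !rmod_hom_nat /= rmorphM alg_homP.
- by move=> T x y; rewrite !rmod_homD /radd /= mulrDr.
- by move=> T a x; rewrite !rmod_homZ /rscale /= mulrCA.
Defined.

End Operations.

Definition dual_structure : module_structure dual_functor.
Proof.
apply: (@ModuleStructure R dual_functor dual_zero dual_add dual_opp dual_scale).
- by move=> S x y z; apply: rmod_hom_ext => T m /=; rewrite addrA.
- by move=> S x y; apply: rmod_hom_ext => T m /=; rewrite addrC.
- by move=> S x; apply: rmod_hom_ext => T m /=; rewrite add0r.
- by move=> S x; apply: rmod_hom_ext => T m /=; rewrite addNr.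
- by move=> S a b x; apply: rmod_hom_ext => T m /=; rewrite rmorphM mulrA.
- by move=> S x; apply: rmod_hom_ext => T m /=; rewrite rmorph1 mul1r.
- by move=> S a x y; apply: rmod_hom_ext => T m /=; rewrite mulrDr.
- by move=> S a b x; apply: rmod_hom_ext => T m /=; rewrite rmorphD mulrDl.
- by move=> S T f x y; apply: rmod_hom_ext.
- by move=> S T f a x; apply: rmod_hom_ext.
Defined.

Definition dual : rmodule R := RModule dual_structure.

End Dual.

Section Bidual.
Variables (R : comPzRingType) (M : rmodule R).

Section Eval.
Variables (S : algebra R) (m : M S).

Definition eval_fun (T : algebra S) (phi : restr (dual M) S T) :
    ring_rmodule S T :=
  (phi : dual_obj M (alg_restr T)) (alg_self (alg_restr T))
    (fmap (alg_str_hom T) m).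

Lemma eval_nat (T U : algebra S) (f : alg_hom T U) (phi : restr (dual M) S T) :
  eval_fun (fmap f phi) = fmap f (eval_fun phi).
Proof.
pose phi' : dual_obj M (alg_restr T) := phi.
pose i : alg_hom (alg_self (alg_restr T))
    (alg_pull (alg_restr_hom f) (alg_self (alg_restr U))) :=
  @AlgHom (alg_restr T) (alg_self (alg_restr T))
    (alg_pull (alg_restr_hom f) (alg_self (alg_restr U))) f (fun r => erefl).
refine (etrans _ (rmod_hom_nat phi' i (fmap (alg_str_hom T) m))).
refine (rmod_hom_arg phi' (alg_pull (alg_restr_hom f) (alg_self (alg_restr U))) _).
by rewrite /= -!fmap_comp; apply: fmap_ext => r /=; rewrite alg_homP.
Qed.

Lemma evalD (T : algebra S) (phi psi : restr (dual M) S T) :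
  eval_fun (radd phi psi) = radd (eval_fun phi) (eval_fun psi).
Proof. by []. Qed.

Lemma evalZ (T : algebra S) (a : T) (phi : restr (dual M) S T) :
  eval_fun (rscale a phi) = rscale a (eval_fun phi).
Proof. by []. Qed.

Definition eval : dual (dual M) S := RModHom eval_nat evalD evalZ.

End Eval.

Lemma bidual_nat (S T : algebra R) (f : alg_hom S T) (m : M S) :
  eval (fmap f m) = fmap f (eval m).
Proof.
apply: rmod_hom_ext => U phi.
pose phi' : dual_obj M (alg_restr U) := phi.
pose W := alg_pull (alg_pull_iso f U) (alg_self (alg_restr (alg_pull f U))).
pose i : alg_hom (alg_self (alg_restr U)) W :=
  @AlgHom (alg_restr U) (alg_self (alg_restr U)) W idfun (fun r => erefl).
refine (etrans (esym (rmod_hom_nat phi' i _)) _).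
refine (rmod_hom_arg phi' W _).
by rewrite /= -!fmap_comp; exact: fmap_ext.
Qed.

Lemma bidualD (S : algebra R) (m n : M S) :
  eval (radd m n) = radd (eval m) (eval n).
Proof.
apply: rmod_hom_ext => T phi.
pose phi' : dual_obj M (alg_restr T) := phi.
refine (etrans _ (@rmod_homD _ _ _ phi' (alg_self (alg_restr T))
  (fmap (alg_str_hom T) m) (fmap (alg_str_hom T) n))).
refine (rmod_hom_arg phi' (alg_self (alg_restr T)) _).
exact: (fmap_madd (rmod_str M) (alg_str_hom T) m n).
Qed.

Lemma bidualZ (S : algebra R) (a : S) (m : M S) :
  eval (rscale a m) = rscale a (eval m).
Proof.
apply: rmod_hom_ext => T phi.
pose phi' : dual_obj M (alg_restr T) := phi.
refine (etrans _ (@rmod_homZ _ _ _ phi' (alg_self (alg_restr T))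
  (alg_map T a) (fmap (alg_str_hom T) m))).
refine (rmod_hom_arg phi' (alg_self (alg_restr T)) _).
exact: (fmap_mscale (rmod_str M) (alg_str_hom T) a m).
Qed.

(* m |-> (phi |-> phi m) *)
Definition bidual_map : rmod_hom M (dual (dual M)) :=
  RModHom bidual_nat bidualD bidualZ.

Definition reflexive_rmodule : Prop := rmod_iso bidual_map.

End Bidual.

Section Tensor.
Variables (R : comPzRingType) (M : lmodType R) (S : algebra R).

(* The list [:: (m_1, s_1); ...; (m_k, s_k)] stands for the sum of the         *)
(* m_i (x) s_i; opposites are given by the (- m_i) (x) s_i.                    *)
Inductive tens_eq : seq (M * S) -> seq (M * S) -> Prop :=
| tens_refl x : tens_eq x x
| tens_sym x y : tens_eq x y -> tens_eq y x
| tens_trans x y z : tens_eq x y -> tens_eq y z -> tens_eq x z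
| tens_cat x x' y y' : tens_eq x x' -> tens_eq y y' ->
    tens_eq (x ++ y) (x' ++ y')
| tens_catC x y : tens_eq (x ++ y) (y ++ x)
| tens_0l s : tens_eq [:: (0, s)] [::]
| tens_Dl m m' s : tens_eq [:: (m + m', s)] [:: (m, s); (m', s)]
| tens_Dr m s s' : tens_eq [:: (m, s + s')] [:: (m, s); (m, s')]
| tens_Z r m s : tens_eq [:: (r *: m, s)] [:: (m, alg_map S r * s)].

Definition tens_eqb (x y : seq (M * S)) : bool := `[< tens_eq x y >].

Lemma tens_eqb_refl : reflexive tens_eqb.
Proof. by move=> x; apply/asboolP; exact: tens_refl. Qed.
Lemma tens_eqb_sym : symmetric tens_eqb.
Proof. by move=> x y; apply/asboolP/asboolP; exact: tens_sym. Qed.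
Lemma tens_eqb_trans : transitive tens_eqb.
Proof. by move=> y x z /asboolP xy /asboolP yz; apply/asboolP; exact: tens_trans yz. Qed.

Definition tens_equiv := EquivRel tens_eqb tens_eqb_refl tens_eqb_sym tens_eqb_trans.

Definition tensor := {eq_quot tens_equiv}.

Definition tens (x : seq (M * S)) : tensor := \pi_tensor x.

Lemma tensE x y : tens x = tens y <-> tens_eq x y.
Proof. by split=> [/eqmodP/asboolP|E]; last by apply/eqmodP/asboolP. Qed.

Lemma tensorP (t : tensor) : exists x, t = tens x.
Proof. by exists (repr t); rewrite /tens reprK. Qed.

Lemma repr_tens x : tens_eq (repr (tens x)) x.
Proof. by apply/tensE; rewrite /tens reprK. Qed.

Definition tens_add (t u : tensor) : tensor := tens (repr t ++ repr u).

Lemma tens_addE x y : tens_add (tens x) (tens y) = tens (x ++ y).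
Proof. by apply/tensE; apply: tens_cat; exact: repr_tens. Qed.

Lemma tens_addA : associative tens_add.
Proof.
move=> t u v; have [x ->] := tensorP t; have [y ->] := tensorP u.
by have [z ->] := tensorP v; rewrite !tens_addE catA.
Qed.

Lemma tens_addC : commutative tens_add.
Proof.
move=> t u; have [x ->] := tensorP t; have [y ->] := tensorP u.
by rewrite !tens_addE; apply/tensE; exact: tens_catC.
Qed.

Lemma tens_add0 : left_id (tens [::]) tens_add.
Proof. by move=> t; have [x ->] := tensorP t; rewrite tens_addE. Qed.

End Tensor.

Section TensorMap.
Variables (R : comPzRingType) (M : lmodType R) (S T : algebra R) (f : S -> T).

Definition tens_map_fun (t : tensor M S) : tensor M T :=
  tens [seq (ms.1, f ms.2) | ms <- repr t].

Variable fD : {morph f : a b / a + b}.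
Variable fZ : forall r s, f (alg_map S r * s) = alg_map T r * f s.

Lemma tens_eq_map (x y : seq (M * S)) : tens_eq x y ->
  tens_eq [seq (ms.1, f ms.2) | ms <- x] [seq (ms.1, f ms.2) | ms <- y].
Proof.
elim=> {x y} [x|x y _|x y z _ H _|x x' y y' _ H _ H'|x y|s|m m' s|m s s'|r m s].
- exact: tens_refl.
- exact: tens_sym.
- exact: tens_trans.
- by rewrite !map_cat; exact: tens_cat.
- by rewrite !map_cat; exact: tens_catC.
- exact: tens_0l.
- exact: tens_Dl.
- by rewrite /= fD; exact: tens_Dr.
- by rewrite /= fZ; exact: tens_Z.
Qed.

Lemma tens_map_funE x :
  tens_map_fun (tens x) = tens [seq (ms.1, f ms.2) | ms <- x].
Proof. by apply/tensE/tens_eq_map/repr_tens. Qed.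

Lemma tens_map_funD t u :
  tens_map_fun (tens_add t u) = tens_add (tens_map_fun t) (tens_map_fun u).
Proof.
have [x ->] := tensorP t; have [y ->] := tensorP u.
by rewrite tens_addE !tens_map_funE tens_addE map_cat.
Qed.

End TensorMap.

Section QuasiCoherent.
Variables (R : comPzRingType) (M : lmodType R).

Definition tens_map (S T : algebra R) (f : alg_hom S T) :
  tensor M S -> tensor M T := tens_map_fun f.

Definition tens_scale (S : algebra R) (a : S) : tensor M S -> tensor M S :=
  tens_map_fun ( *%R a).

Lemma tens_mapE (S T : algebra R) (f : alg_hom S T) x :
  tens_map f (tens x) = tens [seq (ms.1, f ms.2) | ms <- x].
Proof.
apply: tens_map_funE; first exact: rmorphD.
by move=> r s; rewrite rmorphM alg_homP.
Qed.

Lemma tens_scaleE (S : algebra R) (a : S) (x : seq (M * S)) :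
  tens_scale a (tens x) = tens [seq (ms.1, a * ms.2) | ms <- x].
Proof.
by apply: tens_map_funE => [s t|r s]; [rewrite mulrDr|rewrite mulrCA].
Qed.

Lemma tens_map_id (S : algebra R) (t : tensor M S) : tens_map (alg_id S) t = t.
Proof.
have [x ->] := tensorP t; rewrite tens_mapE; congr tens.
by rewrite -[RHS]map_id; apply: eq_map => -[].
Qed.

Lemma tens_map_comp (S T U : algebra R) (g : alg_hom T U) (f : alg_hom S T)
    (t : tensor M S) :
  tens_map (alg_comp g f) t = tens_map g (tens_map f t).
Proof. by have [x ->] := tensorP t; rewrite !tens_mapE -map_comp. Qed.

Definition qc_functor : functor R := Functor tens_map_id tens_map_comp.

Lemma tens_cons (S : algebra R) (ms : M * S) x :
  tens (ms :: x) = tens_add (tens [:: ms]) (tens x).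
Proof. by rewrite tens_addE. Qed.

Lemma tens_scale_add (S : algebra R) (a b : S) (t : tensor M S) :
  tens_scale (a + b) t = tens_add (tens_scale a t) (tens_scale b t).
Proof.
have [x ->] := tensorP t; rewrite !tens_scaleE.
elim: x => [|[m s] x IH] /=; first by rewrite tens_add0.
rewrite tens_cons IH ![tens (_ :: map _ _)]tens_cons.
have -> : tens [:: (m, (a + b) * s)] =
    tens_add (tens [:: (m, a * s)]) (tens [:: (m, b * s)]).
  by rewrite tens_addE mulrDl; apply/tensE; exact: tens_Dr.
rewrite -!tens_addA; congr tens_add; rewrite !tens_addA; congr tens_add.
exact: tens_addC.
Qed.

Lemma tens_scale0 (S : algebra R) (t : tensor M S) :
  tens_scale 0 t = tens [::].
Proof.
have [x ->] := tensorP t; rewrite tens_scaleE.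
elim: x => [//|[m s] x IH] /=; rewrite tens_cons IH.
suff -> : tens [:: (m, 0 * s)] = tens [::] by rewrite tens_add0.
apply/tensE; apply: tens_trans (tens_0l M s); apply: tens_sym.
by have := @tens_Z R M S 0 m s; rewrite scale0r rmorph0.
Qed.

Lemma tens_scale1 (S : algebra R) (t : tensor M S) : tens_scale 1 t = t.
Proof.
have [x ->] := tensorP t; rewrite tens_scaleE; congr tens.
by rewrite -[RHS]map_id; apply: eq_map => -[m s] /=; rewrite mul1r.
Qed.

Lemma tens_scale_addN (S : algebra R) (t : tensor M S) :
  tens_add (tens_scale (-1) t) t = tens [::].
Proof.
by rewrite -{2}[t]tens_scale1 -tens_scale_add addNr tens_scale0.
Qed.

Definition qc_structure : module_structure qc_functor.
Proof.
apply: (@ModuleStructure R qc_functor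
  (fun S => tens [::]) (fun S => @tens_add R M S)
  (fun S => @tens_scale S (-1)) tens_scale).
- by move=> S; exact: tens_addA.
- by move=> S; exact: tens_addC.
- by move=> S; exact: tens_add0.
- by move=> S; exact: tens_scale_addN.
- move=> S a b t; have [x ->] := tensorP t; rewrite !tens_scaleE -map_comp.
  by congr tens; apply: eq_map => ms /=; rewrite mulrA.
- by move=> S t; exact: tens_scale1.
- move=> S a t u; apply: tens_map_funD => [s s'|r s]; first exact: mulrDr.
  exact: mulrCA.
- exact: tens_scale_add.
- move=> S T f t u; apply: tens_map_funD; first exact: rmorphD.
  by move=> r s; rewrite rmorphM alg_homP.
- move=> S T f a t; have [x ->] := tensorP t.
  rewrite /= tens_scaleE !tens_mapE tens_scaleE -!map_comp; congr tens.
  by apply: eq_map => ms /=; rewrite rmorphM.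
Defined.

Definition quasi_coherent : rmodule R := RModule qc_structure.

End QuasiCoherent.

Section Points.
Variables (R : comPzRingType) (X : rscheme R).

Definition point (S : algebra R) : Type := rsch_hom (SpecAlg S) X.

Definition point_map (S T : algebra R) (f : alg_hom S T) (x : point S) : point T :=
  comp_rsch x (SpecAlg_map f).

Lemma point_map_id (S : algebra R) (x : point S) : point_map (alg_id S) x = x.
Proof.
apply: rsch_hom_ext => /=.
rewrite -[RHS]comp_lrs_id; congr comp_lrs; exact: Spec_map_id.
Qed.

Lemma point_map_comp (S T U : algebra R) (g : alg_hom T U) (f : alg_hom S T)
    (x : point S) :
  point_map (alg_comp g f) x = point_map g (point_map f x).
Proof.
apply: rsch_hom_ext => /=; rewrite -comp_lrsA; congr comp_lrs.
exact: Spec_map_comp.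
Qed.

Definition points : functor R := Functor point_map_id point_map_comp.

End Points.

(* Structures of R-module scheme on X are given as structures of R-module on   *)
(* the functor of points of X, which by Yoneda is the same.                    *)
Record module_scheme (R : comPzRingType) := ModuleScheme {
  ms_sch :> rscheme R;
  ms_str : module_structure (points ms_sch) }.

Definition ms_rmodule (R : comPzRingType) (X : module_scheme R) : rmodule R :=
  RModule (ms_str X).

(* Main.v *)
From HB Require Import structures.
From mathcomp Require Import all_boot all_algebra.
From mathcomp Require Import boolp classical_sets functions topology_structure.
From mathcomp Require Import ring.
Require Import Defs.

Set Implicit Arguments.
Unset Strict Implicit.
Unset Printing Implicit Defensive.

Import GRing.Theory.
Local Open Scope classical_set_scope.
Local Open Scope ring_scope.
Local Open Scope quotient_scope.

(* If X is affine, X^. is represented by an algebra A with universal point u.  *)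
(* For e^2 = 0 a point y satisfies a(e y) = a(0) + e (pi a)(y), where pi a is  *)
(* the differential of a along the zero section in the direction u. Hence pi   *)
(* is an R-linear projector of A onto the module N of linear functions on X^., *)
(* and evaluation is a morphism k : X^. -> N^* (N also denoting the quasi-     *)
(* coherent module). The transpose N -> (X^.)^* of k is an isomorphism: phi in *)
(* (X^.)^*(S) is determined by its value at the tautological point over        *)
(* S (+) (N (x) S), because every e y is a specialization of that point. The   *)
(* bidual map of X^. followed by the dual of the transpose is k, so X^. is     *)
(* reflexive if and only if k is an isomorphism. The same argument with k the  *)
(* given isomorphism X^. -> M^* shows that M^* is reflexive.                   *)
(*                                                                             *)
(* M^* is represented by the symmetric algebra of M. If X^. is represented by  *)
(* A, the universal point u : Spec A -> X is an isomorphism: an affine chart   *)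
(* j : Spec B -> X lifts to Spec A along u, and this lift inverts u over the   *)
(* image of j, as one checks on the local rings of Spec A.                     *)

(** * Global sections of an affine scheme *)

(** A morphism [k] from X^. to a dual N^* has a transpose from N to the dual of X^., and the bidual
    map followed by the dual of this transpose is [k] again ([transposeK]). Once the transpose is an
    isomorphism, reflexivity of X^. and invertibility of [k] are therefore the same statement
    ([reflexive_iff_iso]). Both directions supply such a [k]: the given isomorphism with M^* in one,
    evaluation on the linear functions of a representable X^. in the other. In each case
    [transpose_iso] applies, because for every point y the point eps y over the dual numbers is a
    specialization of a single point over a square-zero extension ([dual_qc_transpose_iso],
    [representable_transpose_iso]).

    The rest is geometry: X is affine exactly when its points are represented by an R-algebra
    ([affine_representable], [representable_affine]), and M^* is represented by the symmetric
    algebra ([sym_represents]). Recovering X from its points on affine schemes rests on Hom(Spec S,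
    Spec B) = Hom(B, S), hence on the global sections of Spec ([Spec_map_full], [to_sect_surj]). *)

Definition is_ideal (A : comPzRingType) (I : set A) : Prop :=
  [/\ I 0, forall a b, I a -> I b -> I (a + b) & forall r a, I a -> I (r * a)].

Section PrimeAvoidance.
Variables (A : comPzRingType) (I : set A) (h : A).
Hypotheses (idealI : is_ideal I) (Ih : forall n, ~ I (h ^+ n)).

(* [set0] is included so that the empty chain has an upper bound. *)
Let candidate (J : set A) :=
  J = set0 \/ [/\ is_ideal J, I `<=` J & forall n, ~ J (h ^+ n)].

Lemma candidate_bigcup (F : set (set A)) : F `<=` candidate ->
  total_on F subset -> candidate (\bigcup_(X in F) X).
Proof.
move=> FP Ftot.
have [[J [FJ [a Ja]]]|nF] := EM (exists J, F J /\ J !=set0); last first.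
  left; apply/seteqP; split=> // a [J FJ Ja]; apply: nF.
  by exists J; split=> //; exists a.
have good K b : F K -> K b -> [/\ is_ideal K, I `<=` K & forall n, ~ K (h ^+ n)].
  by move=> /FP[->|].
have [[J0 _ _] IJ _] := good J a FJ Ja.
right; split; last 1 first.
- by move=> n [K FK Kh]; have [_ _ /(_ n)] := good K _ FK Kh.
- split; first by exists J.
    move=> b c [K FK Kb] [L FL Lc].
    have [[_ KD _] _ _] := good K b FK Kb; have [[_ LD _] _ _] := good L c FL Lc.
    have [KL|LK] := Ftot K L FK FL.
      by exists L => //; apply: LD => //; exact: KL.
    by exists K => //; apply: KD => //; exact: LK.
  move=> r b [K FK Kb]; exists K => //.
  by have [[_ _ KM] _ _] := good K b FK Kb; exact: KM.
- by move=> b /IJ Jb; exists J.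
Qed.

(** An ideal maximal among those containing [I] and no power of [h] is prime: if it contained
    neither a nor b, adjoining either would capture a power of [h], and the product of these powers
    lies in the ideal as soon as a b does. *)
Lemma prime_avoiding : exists p : spec A, I `<=` p /\ ~ p h.
Proof.
have [M [MP Mmax]] := Zorn_bigcup candidate_bigcup.
have {MP} [[M0 MD MM] IM Mh] : [/\ is_ideal M, I `<=` M & forall n, ~ M (h ^+ n)].
  (* The maximal candidate is not [set0], since [I] is a larger one. *)
  case: MP => // M0; have [I0 _ _] := idealI; exfalso.
  apply: (Mmax I); last by right; split.
  by rewrite M0; split=> // /(_ 0 I0).
pose add b := [set x | exists m r, M m /\ x = m + r * b].
have big b : ~ M b -> exists n, add b (h ^+ n).
  move=> Mb; apply: contrapT => /forallNP nh.
  have sub : M `<=` add b by move=> m Mm; exists m, 0; rewrite mul0r addr0.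
  apply: (Mmax (add b)).
    by split=> // H; apply: Mb; apply: H; exists 0, 1; rewrite mul1r add0r.
  right; split=> //; last by move=> c /IM /sub.
  split; first exact: sub.
    move=> x y [m [r [Mm ->]]] [m' [r' [Mm' ->]]].
    by exists (m + m'), (r + r'); split; [exact: MD|ring].
  move=> s x [m [r [Mm ->]]]; exists (s * m), (s * r).
  by split; [exact: MM|ring].
have M1 : ~ M 1 by exact: (Mh 0%N).
have Mprime a b : M (a * b) -> M a \/ M b.
  move=> Mab; apply: contrapT => /not_orP[].
  move=> /big[n [m [r [Mm E]]]] /big[k [m' [r' [Mm' F]]]].
  apply: (Mh (n + k)%N); rewrite exprD E F.
  have -> : (m + r * a) * (m' + r' * b) =
     (m' + r' * b) * m + (r * a * m' + r * r' * (a * b)) by ring.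
  by apply: (MD); [exact: MM|apply: MD; exact: MM].
exists (PrimeIdeal M0 MD MM M1 Mprime); split=> //= Mh1; exact: (Mh 1%N).
Qed.

End PrimeAvoidance.

Section GlobalSections.
Variable A : comPzRingType.

(** The local-to-global principle of this part, in the role of compactness and partitions of unity:
    functions that solve a local problem form an ideal, and 1 belongs to it. *)
Lemma ideal_full (I : set A) : is_ideal I ->
  (forall p : spec A, exists2 a, I a & ~ p a) -> I 1.
Proof.
move=> idI H; apply: contrapT => I1.
have [|p [Ip _]] := @prime_avoiding A I 1 idI; first by move=> n; rewrite expr1n.
by have [a /Ip] := H p.
Qed.

Lemma annihilator_ideal (b : A) : is_ideal [set u | u * b = 0].
Proof.
split=> /= [|u v E F|r u E]; first by rewrite mul0r.
  by rewrite mulrDl E F addr0.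
by rewrite -mulrA E mulr0.
Qed.

(** The hypothesis says that b vanishes in A_q for every q in D(h); the annihilator of b lies in no
    such q, so it contains a power of h. *)
Lemma power_annihilates (h b : A) :
  (forall q : spec A, ~ q h -> exists2 u, ~ q u & u * b = 0) ->
  exists n, h ^+ n * b = 0.
Proof.
move=> H; apply: contrapT => /forallNP nh.
have [q [bq qh]] := prime_avoiding (annihilator_ideal b) nh.
by have [u qu ub] := H q qh; apply: qu; apply: bq.
Qed.

Lemma mk_frac_eq0 (p : spec A) a s (ps : ~ p s) :
  mk_frac a ps = 0 <-> exists2 u, ~ p u & u * a = 0.
Proof.
rewrite -mk_frac0 mk_frac_eq; split=> [[u [pu E]]|[u pu E]]; exists u => //.
  by rewrite mulr1 mul0r mulr0 in E.
by rewrite mulr1 mul0r mulr0.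
Qed.

Variable U : opens (spec A).

Definition const_sect (a : A) : spec_sect U :=
  ss_const a (fun q (_ : U q) => @primeN1 A q).

Lemma const_sectD : {morph const_sect : a b / a + b}.
Proof.
move=> a b; apply: spec_sect_ext => p Up; rewrite /= mk_fracD.
by apply: mk_frac_eqw; ring.
Qed.

Lemma const_sect1 : const_sect 1 = 1.
Proof. exact: spec_sect_ext. Qed.

Lemma const_sectM : {morph const_sect : a b / a * b}.
Proof.
move=> a b; apply: spec_sect_ext => p Up; rewrite /= mk_fracM.
by apply: mk_frac_eqw; ring.
Qed.

Definition to_sect : {rmorphism A -> spec_sect U} :=
  mk_rmorphism const_sectD const_sect1 const_sectM.

Lemma to_sectE a p (Up : U p) : to_sect a p Up = mk_frac a (@primeN1 A p).
Proof. by []. Qed.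

Hypothesis Utop : forall p, U p.

Lemma to_sect_inj : injective to_sect.
Proof.
move=> a b E; apply/eqP; rewrite -subr_eq0; apply/eqP.
suff [n] : exists n, 1 ^+ n * (a - b) = 0 by rewrite expr1n mul1r.
apply: power_annihilates => q _.
have /(congr1 (fun f : spec_sect U => f q (Utop q))) : to_sect (a - b) = 0.
  by rewrite rmorphB E subrr.
by move=> /mk_frac_eq0.
Qed.

Lemma sectM (f g : spec_sect U) p (Up : U p) :
  (f * g) p Up = f p Up * g p Up.
Proof. by []. Qed.

Lemma exprS_annihilates (e : A) (g : spec_sect U) n m p (Up : U p) :
  (n <= m)%N -> (to_sect (e ^+ n) * g) p Up = 0 ->
  (to_sect (e ^+ m) * g) p Up = 0.
Proof.
move=> nm E; rewrite -(subnK nm) exprD rmorphM -mulrA sectM E; exact: mulr0.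
Qed.

Lemma vanish_power (e : A) (g : spec_sect U) :
  (forall p : spec A, ~ p e -> g p (Utop p) = 0) -> exists n, to_sect (e ^+ n) * g = 0.
Proof.
move=> g0.
(* [K] is the ideal of the t such that some power of [e] kills [g] on D(t); the claim is that 1 lies
   in [K]. *)
pose K := [set t : A | exists n, forall p : spec A, ~ p t ->
  (to_sect (e ^+ n) * g) p (Utop p) = 0].
suff [n H] : K 1.
  exists n; apply: spec_sect_ext => p Up; rewrite (sect_val_irr _ _ (Utop p)).
  by rewrite H//; exact: prime1.
apply: ideal_full.
  split=> [|a b [n Hn] [m Hm]|r a [n Hn]].
  - by exists 0%N => p; case; exact: prime0.
  - exists (maxn n m) => p pab.
    have [pa|/contrapT pa] := EM (~ p a).
      by apply: (exprS_annihilates (leq_maxl n m)); exact: Hn.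
    apply: (exprS_annihilates (leq_maxr n m)); apply: Hm => pb; apply: pab.
    exact: primeD.
  - by exists n => p pra; apply: Hn; apply: contra_not pra; exact: primeMl.
move=> p; have [V [Vp [b [v gE]]]] := sect_val_frac g (Utop p).
have [E VE] := opensP V.
have VE' q : V q <-> exists2 w, E w & ~ q w.
  split.
    move=> Vq; have : (V : set _) q by []; rewrite VE => /not_subset_prime[w [Ew qw]].
    by exists w.
  move=> [w Ew qw]; have : [set p : spec A | ~ E `<=` p] q.
    by apply/not_subset_prime; exists w.
  by rewrite -VE.
have [w Ew pw] := (VE' p).1 Vp.
have [pv _] := gE p (Utop p) Vp.
exists (w * v); last exact: primeNM.
(* Near p the section is b / v on D(w). It vanishes on D(w v e), so (w v e)^n b = 0, and on D(w v)
   this gives e^n b / v = 0. *)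
have [q|n E0] := @power_annihilates (w * v * e) b.
  move=> qwve.
  have qe : ~ q e by apply: contra_not qwve; exact: primeMl.
  have qw : ~ q w.
    apply: contra_not qwve => qw.
    by rewrite (_ : w * v * e = (v * e) * w); [exact: primeMl|ring].
  have [qv gq] := gE q (Utop q) ((VE' q).2 (ex_intro2 _ _ w Ew qw)).
  by have := g0 q qe; rewrite gq => /mk_frac_eq0.
exists n => q qwv.
have qw : ~ q w.
  by apply: contra_not qwv => qw; rewrite mulrC; exact: primeMl.
have [qv gq] := gE q (Utop q) ((VE' q).2 (ex_intro2 _ _ w Ew qw)).
rewrite sectM gq to_sectE mk_fracM; apply/mk_frac_eq0.
exists ((w * v) ^+ n); last by rewrite mulrA -exprMn.
elim: {E0} n => [|n IH]; first by rewrite expr0; exact: primeN1.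
by rewrite exprS; exact: primeNM.
Qed.

Lemma to_sect_surj (s : spec_sect U) : exists a, to_sect a = s.
Proof.
(* [I] is the ideal of denominators of [s]. *)
pose I := [set t : A | exists a, to_sect a = to_sect t * s].
suff [a] : I 1 by rewrite rmorph1 mul1r; exists a.
apply: ideal_full.
  split=> [|t t' [a aE] [b bE]|r t [a aE]].
  - by exists 0; rewrite !rmorph0 mul0r.
  - by exists (a + b); rewrite !rmorphD aE bE mulrDl.
  - by exists (r * a); rewrite !rmorphM aE mulrA.
move=> p; have [V [Vp [b [v sE]]]] := sect_val_frac s (Utop p).
have [E VE] := opensP V.
have : (V : set _) p by [].
rewrite VE => /not_subset_prime[w [Ew pw]].
(* On D(w) the section v s - b vanishes; a power w^n kills it everywhere, so w^n v is a denominator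
   outside p. *)
have [|n H] := @vanish_power w (to_sect v * s - to_sect b).
  move=> q qw.
  have Vq : V q.
    have : [set p : spec A | ~ E `<=` p] q.
      by apply/not_subset_prime; exists w.
    by rewrite -VE.
  have [qv sq] := sE q (Utop q) Vq.
  rewrite -[LHS]/(mk_frac v (@primeN1 A q) * s q (Utop q) - mk_frac b (@primeN1 A q)).
  rewrite sq mk_fracM mk_fracN mk_fracD; apply/mk_frac_eq0; exists 1.
    exact: primeN1.
  by ring.
have [pv _] := sE p (Utop p) Vp.
exists (w ^+ n * v).
  exists (w ^+ n * b); apply/eqP; rewrite eq_sym -subr_eq0; apply/eqP.
  by rewrite -[RHS]H !rmorphM mulrBr mulrA.
elim: {H} n => [|n IH]; first by rewrite expr0 mul1r.
by rewrite exprS -mulrA; exact: primeNM.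
Qed.

End GlobalSections.

(** * Morphisms between affine schemes *)

Definition opensT (X : topologicalType) : opens X := Opens openT.

Lemma hom_pull_germ_unit (X Y : lrs) (f : lrs_hom X Y) (V : opens Y)
    (s : sect V) (x : X) : germ_unit s (f x) -> germ_unit (hom_pull f V s) x.
Proof.
move=> [W [WV [Wx [t st]]]].
have HW : preim_opens (hom_cont f) W `<=` preim_opens (hom_cont f) V.
  by move=> y; exact: WV.
exists (preim_opens (hom_cont f) W), HW; split=> //.
by exists (hom_pull f W t); rewrite -(hom_pull_res f WV HW) -rmorphM st rmorph1.
Qed.

Section SpecFull.
Variables (S B : comPzRingType) (h : lrs_hom (Spec S) (Spec B)).

Let VB : opens (spec B) := opensT (spec B).
Let US : opens (spec S) := preim_opens (hom_cont h) VB.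

Let USP (p : spec S) : US p. Proof. by []. Qed.
Let VBP (p : spec B) : VB p. Proof. by []. Qed.

Definition hom_ring_fun (b : B) : S :=
  projT1 (cid (to_sect_surj USP (hom_pull h VB (to_sect VB b)))).

Lemma hom_ring_funE b : to_sect US (hom_ring_fun b) = hom_pull h VB (to_sect VB b).
Proof. by rewrite /hom_ring_fun; case: cid. Qed.

Lemma hom_ring_funD : {morph hom_ring_fun : a b / a + b}.
Proof.
move=> a b; apply: (to_sect_inj USP).
by rewrite rmorphD !hom_ring_funE rmorphD; exact: (rmorphD (hom_pull h VB)).
Qed.

Lemma hom_ring_fun1 : hom_ring_fun 1 = 1.
Proof.
apply: (to_sect_inj USP); rewrite hom_ring_funE.
rewrite (rmorph1 (to_sect VB)) (rmorph1 (to_sect US)).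
exact: (rmorph1 (hom_pull h VB)).
Qed.

Lemma hom_ring_funM : {morph hom_ring_fun : a b / a * b}.
Proof.
move=> a b; apply: (to_sect_inj USP).
by rewrite rmorphM !hom_ring_funE rmorphM; exact: (rmorphM (hom_pull h VB)).
Qed.

Definition hom_ring : {rmorphism B -> S} :=
  mk_rmorphism hom_ring_funD hom_ring_fun1 hom_ring_funM.

Lemma hom_ringE b : to_sect US (hom_ring b) = hom_pull h VB (to_sect VB b).
Proof. exact: hom_ring_funE. Qed.

Lemma to_sect_germ_unit (A : comPzRingType) (U : opens (spec A)) (p : spec A)
    (a : A) (Up : U p) : @germ_unit (Spec A) U (to_sect U a) p <-> ~ p a.
Proof.
rewrite -(frac_unitP a (@primeN1 A p)); exact: (spec_germ_unit _ Up).
Qed.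

(** Locality on stalks enters here: b is a unit at h q if and only if its pullback is a unit at
    q. *)
Lemma hom_comap (q : spec S) : h q = comap hom_ring q.
Proof.
apply: spec_ext => b.
apply: iff_trans (_ : ~ ~ q (hom_ring b) <-> _); last first.
  by split=> [/contrapT|qb]; last by apply.
rewrite -(@to_sect_germ_unit _ US q) // hom_ringE.
split=> [hb|H].
  move=> /(@hom_local _ _ h VB _ q (VBP _)) /(to_sect_germ_unit _ (VBP _)).
  exact.
apply: contrapT => hb; apply: H.
by apply: hom_pull_germ_unit; apply/(to_sect_germ_unit b (VBP (h q))).
Qed.

Lemma res_to_sect (A : comPzRingType) (U V : opens (spec A)) (VU : V `<=` U) a :
  @res (Spec A) U V VU (to_sect U a) = to_sect V a.
Proof. exact: spec_sect_ext. Qed.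

(** On a neighbourhood where s = a' / v', the identity s v' = a' between sections is pulled back;
    then a' / v' is compared with a / v in the local ring at h p. *)
Lemma hom_pull_frac (V : opens (spec B)) (s : spec_sect V) (p : spec S)
    (hp : V (h p)) a v (nv : ~ p (hom_ring v)) (nv' : ~ h p v) :
  s (h p) hp = mk_frac a nv' ->
  (hom_pull h V s : spec_sect _) p hp = mk_frac (hom_ring a) nv.
Proof.
move=> sp.
have [W0 [W0p [a' [v' sE]]]] := sect_val_frac s hp.
pose W := opensI V W0.
have WV : W `<=` V by move=> q [].
have HWV : preim_opens (hom_cont h) W `<=` preim_opens (hom_cont h) V.
  by move=> q; exact: WV.
have WT : W `<=` VB by [].
have HWT : preim_opens (hom_cont h) W `<=` US by [].
have pullto b : hom_pull h W (to_sect W b) = to_sect _ (hom_ring b).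
  by rewrite -(res_to_sect WT) (hom_pull_res h WT HWT) -hom_ringE res_to_sect.
have E : @res (Spec B) _ _ WV s * to_sect W v' = to_sect W a'.
  apply: spec_sect_ext => q Wq; rewrite sectM /=.
  have [qv ->] := sE q (WV q Wq) (proj2 Wq).
  by rewrite mk_fracM; apply: mk_frac_eqw; ring.
have Wp : W (h p) by [].
have := congr1 (hom_pull h W) E.
rewrite rmorphM !pullto (hom_pull_res h WV HWV).
move=> /(congr1 (fun f : spec_sect (preim_opens (hom_cont h) W) => f p Wp)) F0.
have {F0} F : (hom_pull h V s : spec_sect (preim_opens (hom_cont h) V)) p hp *
    mk_frac (hom_ring v') (@primeN1 S p) = mk_frac (hom_ring a') (@primeN1 S p).
  by rewrite -[RHS]F0 [RHS]sectM (sect_val_irr _ _ (HWV p Wp)).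
have [nv0' E'] := sE _ hp W0p; rewrite sp in E'.
have nv0 : ~ p (hom_ring v') by move: (nv0'); rewrite hom_comap.
have [b [w [pw pE]]] := locP ((hom_pull h V s : spec_sect _) p hp).
rewrite pE in F *.
move: F; rewrite mk_fracM => /mk_frac_eq[u [pu F]].
move/mk_frac_eq: E' => [u' [hu' /(congr1 hom_ring)]].
rewrite !rmorphM => E'.
have pu' : ~ p (hom_ring u') by move: (hu'); rewrite hom_comap.
apply/mk_frac_eq; exists (u * hom_ring u' * hom_ring v'); split.
  by apply: primeNM => //; exact: primeNM.
transitivity (hom_ring u' * hom_ring v * (u * (b * hom_ring v' * 1))); first by ring.
rewrite F.
transitivity (u * w * (hom_ring u' * (hom_ring a' * hom_ring v))); first by ring.
by rewrite -E'; ring.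
Qed.

Lemma Spec_map_full : h = Spec_map hom_ring.
Proof.
apply: lrs_hom_ext => [p|V U hf hg s]; first exact: hom_comap.
apply: spec_sect_ext => p Up /=.
have [a [v [pv sp]]] := locP ((s : spec_sect V) _ (hg p Up)).
have hpv : ~ h p v by rewrite hom_comap.
have := @hom_pull_frac V s p (hf p Up) a v _ hpv.
rewrite (sect_val_transport (hf p Up : (V : set _) (h p)) hpv
  (esym (hom_comap p)) sp) => /(_ pv erefl) ->.
by rewrite sp loc_map_funE.
Qed.

End SpecFull.

Lemma Spec_map_inj (B S : comPzRingType) (f g : {rmorphism B -> S}) :
  Spec_map f = Spec_map g -> f = g.
Proof.
move=> E; apply: rmorphism_ext => b.
apply: (@to_sect_inj S (opensT _)) => //.
have pullE (h : {rmorphism B -> S}) (k : lrs_hom (Spec S) (Spec B)) :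
    k = Spec_map h ->
    forall (H : opensT (spec S) `<=` preim_opens (hom_cont k) (opensT _)),
    to_sect (opensT (spec S)) (h b) =
    @res (Spec S) _ _ H (hom_pull k (opensT _) (to_sect _ b)).
  move=> -> H; apply: spec_sect_ext => p Up.
  rewrite /= loc_map_funE; apply: mk_frac_eqw.
  by rewrite rmorph1.
have H : opensT (spec S) `<=` preim_opens (hom_cont (Spec_map f)) (opensT _) by [].
by rewrite (@pullE f _ erefl H) (@pullE g _ E H).
Qed.

(** * Factorization through an open immersion *)

Section OpenImmersionFactor.
Variables (X Y Z : lrs) (j : lrs_hom X Y) (h : lrs_hom Z Y).
Hypotheses (jP : open_immersion j) (hj : forall z, range j (h z)).

Let j_inj : injective j. Proof. by case: jP. Qed.

Definition image_opens (U : opens X) : opens Y :=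
  Opens (let: And3 _ H _ := jP in H U).

Lemma image_opens_pull_bij (U : opens X) :
  bijective (hom_pull j (image_opens U)).
Proof. by case: jP => _ _; apply=> _ [x _ <-]; exists x. Qed.

Lemma preim_image_opens (U : opens X) :
  preim_opens (hom_cont j) (image_opens U) `<=` U.
Proof. by move=> x [x' Ux' /j_inj <-]. Qed.

Definition factor_fun (z : Z) : X := projT1 (cid2 (hj z)).

Lemma factor_funE z : j (factor_fun z) = h z.
Proof. by rewrite /factor_fun; case: cid2. Qed.

Lemma factor_fun_image (U : opens X) z :
  U (factor_fun z) <-> image_opens U (h z).
Proof.
split=> [Uz|[x Ux /=]]; first by exists (factor_fun z) => //; exact: factor_funE.
by rewrite -factor_funE => /j_inj <-.
Qed.

Lemma factor_cont : continuous factor_fun.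
Proof.
apply/continuousP => U oU.
suff -> : factor_fun @^-1` U =
    preim_opens (hom_cont h) (image_opens (Opens oU)) by exact: opensP.
by apply/seteqP; split=> z /(factor_fun_image (Opens oU)).
Qed.

Section Pull.
Variable U : opens X.

Lemma descend_subproof (s : sect U) :
  exists t, hom_pull j (image_opens U) t = res (@preim_image_opens U) s.
Proof.
by have [g _ gK] := image_opens_pull_bij U; exists (g (res (@preim_image_opens U) s)).
Qed.

Definition descend (s : sect U) : sect (image_opens U) :=
  projT1 (cid (descend_subproof s)).

Lemma descendE s :
  hom_pull j (image_opens U) (descend s) = res (@preim_image_opens U) s.
Proof. by rewrite /descend; case: cid. Qed.

(** Additivity, multiplicativity and compatibility with restriction of [descend] all follow from
    this characterization. *)
Lemma descend_uniq s t :
  hom_pull j (image_opens U) t = res (@preim_image_opens U) s -> t = descend s.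
Proof. by rewrite -descendE => /(bij_inj (image_opens_pull_bij U)). Qed.

Lemma factor_preim_sub : preim_opens factor_cont U `<=`
  preim_opens (hom_cont h) (image_opens U).
Proof. by move=> z /factor_fun_image. Qed.

Definition factor_pull_fun (s : sect U) : sect (preim_opens factor_cont U) :=
  res factor_preim_sub (hom_pull h (image_opens U) (descend s)).

Lemma factor_pullD : {morph factor_pull_fun : s t / s + t}.
Proof.
move=> s t; rewrite /factor_pull_fun -!rmorphD; congr (res _ (hom_pull _ _ _)).
by apply/esym/descend_uniq; rewrite !rmorphD !descendE.
Qed.

Lemma factor_pull1 : factor_pull_fun 1 = 1.
Proof.
rewrite /factor_pull_fun -(@descend_uniq 1 1); first by rewrite !rmorph1.
by rewrite !rmorph1.
Qed.

Lemma factor_pullM : {morph factor_pull_fun : s t / s * t}.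
Proof.
move=> s t; rewrite /factor_pull_fun -!rmorphM; congr (res _ (hom_pull _ _ _)).
by apply/esym/descend_uniq; rewrite !rmorphM !descendE.
Qed.

Definition factor_pull : {rmorphism sect U -> sect (preim_opens factor_cont U)} :=
  mk_rmorphism factor_pullD factor_pull1 factor_pullM.

End Pull.

Lemma factor_pull_res (V W : opens X) (WV : W `<=` V)
    (H : preim_opens factor_cont W `<=` preim_opens factor_cont V) (s : sect V) :
  factor_pull W (res WV s) = res H (factor_pull V s).
Proof.
have iWV : image_opens W `<=` image_opens V by move=> y [x /WV Vx <-]; exists x.
have jWV : preim_opens (hom_cont j) (image_opens W) `<=`
    preim_opens (hom_cont j) (image_opens V) by move=> x /iWV.
have hWV : preim_opens (hom_cont h) (image_opens W) `<=`
    preim_opens (hom_cont h) (image_opens V) by move=> x /iWV.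
rewrite /= /factor_pull_fun.
rewrite (_ : descend (res WV s) = res iWV (descend s)).
  by rewrite (hom_pull_res h iWV hWV) !res_trans; exact: res_irr.
apply/esym/descend_uniq.
rewrite (hom_pull_res j iWV jWV) descendE !res_trans; exact: res_irr.
Qed.

(** Locality of [h] makes the germ of [descend s] at h z a unit; as h z is the image of
    [factor_fun z] under [j], pulling back along [j] gives a unit germ of [s]. *)
Lemma factor_pull_local (V : opens X) (s : sect V) (z : Z) : V (factor_fun z) ->
  germ_unit (factor_pull V s) z -> germ_unit s (factor_fun z).
Proof.
move=> Vz /germ_unit_res /= /(_ Vz) /(hom_local h).
move=> /(_ (proj1 (factor_fun_image V z) Vz)); rewrite -factor_funE.
move=> /hom_pull_germ_unit; rewrite descendE => /germ_unit_res; apply.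
by exists (factor_fun z).
Qed.

Definition factor : lrs_hom Z X := LrsHom factor_pull_res factor_pull_local.

Lemma factorE : comp_lrs j factor = h.
Proof.
apply: lrs_hom_ext => [z|V U hf hg s]; first exact: factor_funE.
have iV : image_opens (preim_opens (hom_cont j) V) `<=` V by move=> y [x Vx <-].
have jV : preim_opens (hom_cont j) (image_opens (preim_opens (hom_cont j) V))
    `<=` preim_opens (hom_cont j) V by move=> x /iV.
have hV : preim_opens (hom_cont h) (image_opens (preim_opens (hom_cont j) V))
    `<=` preim_opens (hom_cont h) V by move=> x /iV.
rewrite /= /comp_lrs_pull /= /factor_pull_fun.
rewrite -(descend_uniq (t := res iV s)); last first.
  by rewrite (hom_pull_res j iV jV); exact: res_irr.
by rewrite (hom_pull_res h iV hV) !res_trans; exact: res_irr.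
Qed.

End OpenImmersionFactor.

(** * Schemes with representable functor of points *)

Section ClosedPoint.
Variables (A : comPzRingType) (q : spec A).

Definition to_loc_fun (a : A) : loc q := mk_frac a (@primeN1 A q).

Lemma to_locD : {morph to_loc_fun : a b / a + b}.
Proof. by move=> a b; rewrite /to_loc_fun mk_fracD; apply: mk_frac_eqw; ring. Qed.

Lemma to_locM : {morph to_loc_fun : a b / a * b}.
Proof. by move=> a b; rewrite /to_loc_fun mk_fracM; apply: mk_frac_eqw; ring. Qed.

Definition to_loc : {rmorphism A -> loc q} :=
  mk_rmorphism to_locD (erefl : to_loc_fun 1 = 1) to_locM.

Let nonunit := [set x : loc q | ~ exists y, x * y = 1].

Let nonunitE a s (qs : ~ q s) : nonunit (mk_frac a qs) <-> q a.
Proof.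
rewrite /nonunit /= frac_unitP.
by split=> [/contrapT|qa]; last by apply.
Qed.

Lemma nonunit0 : nonunit 0.
Proof. by rewrite -(mk_frac0 q); apply/nonunitE; exact: prime0. Qed.

Lemma nonunitD x y : nonunit x -> nonunit y -> nonunit (x + y).
Proof.
have [a [s [qs ->]]] := locP x; have [b [t [qt ->]]] := locP y.
rewrite mk_fracD => /nonunitE qa /nonunitE qb; apply/nonunitE.
by apply: primeD; rewrite mulrC; exact: primeMl.
Qed.

Lemma nonunitMl x y : nonunit y -> nonunit (x * y).
Proof.
have [a [s [qs ->]]] := locP x; have [b [t [qt ->]]] := locP y.
by rewrite mk_fracM => /nonunitE qb; apply/nonunitE; exact: primeMl.
Qed.

Lemma nonunit1 : ~ nonunit 1.
Proof. by rewrite -(mk_frac1 q) => /nonunitE; exact: prime1. Qed.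

Lemma nonunitM x y : nonunit (x * y) -> nonunit x \/ nonunit y.
Proof.
have [a [s [qs ->]]] := locP x; have [b [t [qt ->]]] := locP y.
by rewrite mk_fracM => /nonunitE /primeM[]; [left|right]; apply/nonunitE.
Qed.

Definition closed_point : spec (loc q) :=
  PrimeIdeal nonunit0 nonunitD nonunitMl nonunit1 nonunitM.

Lemma comap_closed_point : comap to_loc closed_point = q.
Proof. by apply: spec_ext => a; exact: nonunitE. Qed.

Lemma comap_to_loc_sub (r : spec (loc q)) : comap to_loc r `<=` q.
Proof.
move=> a /= ra; apply: contrapT => qa; apply: (@prime1 _ r).
have [y <-] := (frac_unitP a (@primeN1 A q)).2 qa.
by rewrite mulrC; apply: primeMl; exact: ra.
Qed.

(** Localizing A_q at its maximal ideal loses nothing, because the elements outside that ideal are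
    already units. *)
Lemma loc_map_closed_point_inj (x : loc (comap to_loc closed_point)) :
  loc_map to_loc closed_point x = 0 -> x = 0.
Proof.
have [a [s [ps ->]]] := locP x; rewrite -[LHS]/(loc_map_fun _) loc_map_funE.
move=> /mk_frac_eq0[y qy ya]; apply/mk_frac_eq0.
have [z yz] : exists z, y * z = 1 by exact: contrapT.
have : to_loc a = 0 by rewrite -[to_loc a]mul1r -yz mulrAC ya mul0r.
by rewrite -[to_loc a]/(mk_frac _ _) => /mk_frac_eq0[u qu ua]; exists u;
  rewrite ?comap_closed_point.
Qed.

End ClosedPoint.

Lemma id_comp_lrs (X Y : lrs) (f : lrs_hom X Y) : comp_lrs (id_lrs Y) f = f.
Proof.
apply: lrs_hom_ext => // V U hf hg s; rewrite /= /comp_lrs_pull /= /id_lrs_pull.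
have h : preim_opens (hom_cont f) (preim_opens (@id_lrs_cont Y) V) `<=`
  preim_opens (hom_cont f) V by [].
by rewrite (hom_pull_res f _ h) !res_trans; exact: res_irr.
Qed.

Lemma hom_pull_eq (X Y : lrs) (f g : lrs_hom X Y) (V : opens Y) (U : opens X)
    (hf : U `<=` preim_opens (hom_cont f) V)
    (hg : U `<=` preim_opens (hom_cont g) V) (s : sect V) :
  f = g -> res hf (hom_pull f V s) = res hg (hom_pull g V s).
Proof. by move=> e; subst g; exact: res_irr. Qed.

Lemma hom_pull_comp (X Y Z : lrs) (g : lrs_hom Y Z) (f : lrs_hom X Y)
    (e : lrs_hom X Z) (V : opens Z) (U : opens X)
    (he : U `<=` preim_opens (hom_cont e) V)
    (hf : U `<=` preim_opens (hom_cont f) (preim_opens (hom_cont g) V))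
    (s : sect V) :
  comp_lrs g f = e ->
  res he (hom_pull e V s) = res hf (hom_pull f _ (hom_pull g V s)).
Proof.
move=> E; rewrite -(hom_pull_eq (hf : U `<=` preim_opens (hom_cont (comp_lrs g f)) V) _ _ E).
by rewrite /= /comp_lrs_pull /= res_trans; exact: res_irr.
Qed.

(** * Representability by an algebra, and its equivalence with affineness *)

Section Representable.
Variables (R : comPzRingType) (F : functor R).

Definition represents (A : algebra R) (u : F A) : Prop :=
  forall (S : algebra R) (x : F S),
    exists f : alg_hom A S, fmap f u = x /\ forall g, fmap g u = x -> g = f.

Lemma represents_inj (A : algebra R) (u : F A) (S : algebra R)
    (f g : alg_hom A S) : represents u -> fmap f u = fmap g u -> f = g.
Proof. by move=> /(_ S (fmap g u))[h [_ H]] /H ->; rewrite [RHS]H. Qed.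

End Representable.

Lemma alg_hom_of_lrs (R : comPzRingType) (A S : algebra R)
    (k : lrs_hom (Spec S) (Spec A)) :
  comp_lrs (Spec_map (alg_map A)) k = Spec_map (alg_map S) ->
  exists f : alg_hom A S, k = Spec_map f.
Proof.
rewrite (Spec_map_full k) -Spec_map_comp => /Spec_map_inj E.
have kP r : hom_ring k (alg_map A r) = alg_map S r.
  by rewrite -E.
by exists (AlgHom kP).
Qed.

Section AffineRepresentable.
Variables (R : comPzRingType) (X : rscheme R).

(** The algebra structure comes from the composite Spec B -> X -> Spec R, and the isomorphism Spec B
    -> X is the universal point. *)
Lemma affine_representable : is_affine X ->
  exists (A : algebra R) (u : points X A), represents u.
Proof.
move=> [B [f [g [gf fg]]]].
pose A := @Algebra R B (hom_ring (comp_lrs (rsch_str X) g)).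
have uP : comp_lrs (rsch_str X) g = rsch_str (SpecAlg A).
  exact: Spec_map_full.
pose u : points X A := @RSchHom R (SpecAlg A) X g uP.
exists A, u => S x.
have [|k kE] := @alg_hom_of_lrs R A S (comp_lrs f x).
  rewrite -[RHS](rsch_homP x) -[Spec_map _]/(rsch_str (SpecAlg A)) -uP.
  by rewrite comp_lrsA -(comp_lrsA _ g f) gf comp_lrs_id.
exists k; split=> [|k' E].
  apply: rsch_hom_ext => /=; rewrite -kE comp_lrsA gf.
  exact: id_comp_lrs.
apply: alg_hom_ext => a; suff -> : alg_hom_fun k' = alg_hom_fun k by [].
apply: Spec_map_inj; rewrite -kE -E /= comp_lrsA fg.
exact/esym/id_comp_lrs.
Qed.

End AffineRepresentable.

Section RepresentableAffine.
Variables (R : comPzRingType) (X : rscheme R) (A : algebra R) (u : points X A).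
Hypothesis uP : represents u.

(** Representability speaks of R-morphisms; a bare ring [S] becomes an R-algebra through [k], and
    [l] induces the same structure because [u] lies over Spec R. *)
Lemma universal_monic (S : comPzRingType) (k l : lrs_hom (Spec S) (Spec A)) :
  comp_lrs u k = comp_lrs u l -> k = l.
Proof.
move=> kl; pose ST := @Algebra R S (hom_ring (comp_lrs (Spec_map (alg_map A)) k)).
have [|f kf] := @alg_hom_of_lrs R A ST k; first exact: Spec_map_full.
have [|g lg] := @alg_hom_of_lrs R A ST l.
  rewrite -[RHS]Spec_map_full -[Spec_map _]/(rsch_str (SpecAlg A)) -(rsch_homP u).
  by rewrite -!comp_lrsA kl.
suff fg : f = g by rewrite kf lg fg.
apply: (represents_inj uP).
by apply: rsch_hom_ext; rewrite /= -kf -lg.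
Qed.

Lemma chart_lift (B : comPzRingType) (j : lrs_hom (Spec B) X) :
  exists phi : {rmorphism A -> B}, comp_lrs u (Spec_map phi) = j.
Proof.
pose BR := @Algebra R B (hom_ring (comp_lrs (rsch_str X) j)).
have jP : comp_lrs (rsch_str X) j = rsch_str (SpecAlg BR) by exact: Spec_map_full.
have [f [fE _]] := uP (@RSchHom R (SpecAlg BR) X j jP).
by exists f; exact: (congr1 (@rsch_hom_lrs _ _ _) fE).
Qed.

Section Chart.
Variables (B : comPzRingType) (j : lrs_hom (Spec B) X) (phi : {rmorphism A -> B}).
Hypotheses (jP : open_immersion j) (phiE : comp_lrs u (Spec_map phi) = j).

Lemma chartE y : u (comap phi y) = j y.
Proof. by rewrite -phiE. Qed.

Lemma chart_preim (W : opens X) : preim_opens (hom_cont j) W `<=`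
  preim_opens (hom_cont (Spec_map phi)) (preim_opens (hom_cont u) W).
Proof.
by move=> y Wy; suff: W (u (comap phi y)) by []; rewrite chartE.
Qed.

(* The morphism Spec A_q -> Spec A -> X factors through the chart, because its *)
(* image consists of generizations of u q; by monicity of u, the factorization *)
(* composed with Spec phi is the canonical morphism Spec A_q -> Spec A.        *)
Lemma local_lift (q : spec A) : range j (u q) ->
  exists k : lrs_hom (Spec (loc q)) (Spec B),
    comp_lrs (Spec_map phi) k = Spec_map (to_loc q).
Proof.
move=> [y _ jy].
have hj r : range j (comp_lrs u (Spec_map (to_loc q)) r).
  pose O := preim_opens (hom_cont u) (image_opens jP (opensT (spec B))).
  have [E OE] := opensP O.
  have : (O : set _) q by exists y.
  rewrite OE => /not_subset_prime[a [Ea qa]].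
  suff : (O : set _) (comap (to_loc q) r) by case=> z _ zE; exists z.
  rewrite OE; apply/not_subset_prime; exists a; split=> //.
  by move=> /comap_to_loc_sub.
exists (factor jP hj); apply: universal_monic.
by rewrite comp_lrsA phiE factorE.
Qed.

Lemma lift_closed_point (q : spec A) (k : lrs_hom (Spec (loc q)) (Spec B)) :
  comp_lrs (Spec_map phi) k = Spec_map (to_loc q) ->
  comap phi (k (closed_point q)) = q.
Proof.
move=> kE; have := comap_closed_point q.
by rewrite -[comap _ _]/(Spec_map (to_loc q) (closed_point q)) -kE.
Qed.

(** The lift of Spec A_q sends the closed point to a point of the chart above q, and injectivity of
    [j] identifies it with y. *)
Lemma chart_point (q : spec A) y : u q = j y -> q = comap phi y.
Proof.
move=> qy; have [|k kE] := @local_lift q; first by exists y.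
have E : comap phi (k (closed_point q)) = q.
  exact: (lift_closed_point kE).
rewrite -{1}E; congr comap; have [j_inj _ _] := jP; apply: j_inj.
by rewrite -chartE E.
Qed.

(** A section that dies on the chart dies on Spec A_q, whose morphism to Spec A factors through the
    chart; at the closed point the pullback to Spec A_q is injective on germs. *)
Lemma chart_section (W : opens (spec A)) (d : spec_sect W)
    (V : opens (spec B)) (hV : V `<=` preim_opens (hom_cont (Spec_map phi)) W) y
    (hy : W (comap phi y)) :
  V y -> @res (Spec B) _ _ hV (hom_pull (Spec_map phi) W d) = 0 ->
  d (comap phi y) hy = 0.
Proof.
move=> Vy d0; move: hy; set q := comap phi y => hy.
have [|k kE] := @local_lift q; first by exists y => //; rewrite chartE.
have ky : k (closed_point q) = y.
  have [j_inj _ _] := jP; apply: j_inj; rewrite -!chartE; congr (u _).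
  exact: (lift_closed_point kE).
pose U := preim_opens (hom_cont k) V.
have Uq : U (closed_point q) by rewrite /U /= ky.
have hkV : U `<=` preim_opens (hom_cont k) (preim_opens (hom_cont (Spec_map phi)) W).
  by move=> r /hV.
have he : U `<=` preim_opens (hom_cont (Spec_map (to_loc q))) W.
  move=> r Ur; have := hkV r Ur.
  by rewrite -[X in X -> _]/(W (comp_lrs (Spec_map phi) k r)) kE.
have E : @res (Spec (loc q)) _ _ he (hom_pull (Spec_map (to_loc q)) W d) = 0.
  rewrite (hom_pull_comp he hkV d kE).
  by rewrite -(hom_pull_res k hV hkV) [res _ _]d0 rmorph0.
have := congr1 (fun f : spec_sect U => f (closed_point q) Uq) E.
move=> /= /loc_map_closed_point_inj; move: (he _ Uq).
have [a [s [qs ds]]] := locP (d q hy).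
move=> he'; have qs' : ~ comap (to_loc q) (closed_point q) s by rewrite comap_closed_point.
rewrite (sect_val_transport (he' : (W : set _) (comap (to_loc q) (closed_point q))) qs'
  (esym (comap_closed_point q)) ds).
move=> /mk_frac_eq0[v]; rewrite comap_closed_point => qv va.
by rewrite ds; apply/mk_frac_eq0; exists v.
Qed.

End Chart.

Lemma universal_chart (q : spec A) : exists (B : comPzRingType)
    (j : lrs_hom (Spec B) X) (phi : {rmorphism A -> B}) (y : spec B),
  [/\ open_immersion j, comp_lrs u (Spec_map phi) = j, u q = j y & q = comap phi y].
Proof.
have [B [j [jP [y _ jy]]]] := sch_cover (u q); have [phi phiE] := chart_lift j.
by exists B, j, phi, y; split=> //; apply: chart_point phiE _ _ _.
Qed.

Definition in_chart (W : opens X) : Prop :=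
  exists (B : comPzRingType) (j : lrs_hom (Spec B) X),
    open_immersion j /\ W `<=` range j.

Lemma in_chart_pull_inj (W : opens X) (s t : sect W) :
  in_chart W -> hom_pull u W s = hom_pull u W t -> s = t.
Proof.
move=> [B [j [jP Wj]]] st; have [phi phiE] := chart_lift j.
have [_ _ /(_ W Wj)/bij_inj inj] := jP; apply: inj.
have h := @chart_preim _ j phi phiE W.
rewrite -[LHS](res_id (@subset_refl _ _)) -[RHS](res_id (@subset_refl _ _)).
by rewrite !(hom_pull_comp _ h _ phiE) st.
Qed.

(** The preimage is found by pulling s back to Spec B and descending along [j]; [chart_section]
    carries the equality from Spec B to Spec A, point by point. *)
Lemma in_chart_pull_surj (W : opens X) (s : sect (preim_opens (hom_cont u) W)) :
  in_chart W -> exists t, hom_pull u W t = s.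
Proof.
move=> [B [j [jP Wj]]]; have [phi phiE] := chart_lift j.
have h := @chart_preim _ j phi phiE W.
have [_ _ /(_ W Wj)[g _ gK]] := jP.
exists (g (res h (hom_pull (Spec_map phi) _ s))).
set t := g _; apply/eqP; rewrite -subr_eq0; apply/eqP.
apply: spec_sect_ext => q Wq.
have [y _ jy] := Wj _ Wq.
have qE := chart_point jP phiE (esym jy); move: Wq; rewrite qE => Wq.
have Wy : preim_opens (hom_cont j) W y by rewrite /= -(chartE phiE).
rewrite (@chart_section _ _ _ jP phiE _ _ _ h y Wq Wy) //.
rewrite !rmorphB /=.
rewrite -[X in X - _](@hom_pull_comp _ _ _ u (Spec_map phi) j W _ (@subset_refl _ _)) //.
by rewrite res_id /t gK subrr.
Qed.

Lemma universal_open_immersion : open_immersion u.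
Proof.
split=> [q q'|W|V _].
- have [B [j [phi [y [jP phiE qy ->]]]]] := universal_chart q.
  by rewrite (chartE phiE) => /esym /(chart_point jP phiE) ->.
- rewrite (_ : _ @` _ = \bigcup_(V in [set V : opens X | V `<=` u @` W]) V).
    by apply: bigcup_open => V _; exact: opensP.
  apply/seteqP; split=> [_ [q Wq <-]|x [V VW /VW] //].
  have [B [j [phi [y [jP phiE qy qE]]]]] := universal_chart q.
  exists (image_opens jP (preim_opens (hom_cont (Spec_map phi)) W)).
    by move=> _ [z Wz <-]; exists (comap phi z) => //; exact: (chartE phiE).
  by rewrite qy; exists y => //=; rewrite /preimage /= -qE.
(* Over opens contained in a chart the pullback is already bijective; the sheaf axioms on both sides
   extend this to [V]. *)
pose I := {W : opens X | W `<=` V /\ in_chart W}.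
pose O (i : I) := projT1 i.
have OV (i : I) : O i `<=` V by case: (projT2 i).
have Oc (i : I) : in_chart (O i) by case: (projT2 i).
have cov : V `<=` \bigcup_i O i.
  move=> x Vx; have [B [j [jP [y _ jy]]]] := sch_cover x.
  pose W := opensI V (image_opens jP (opensT (spec B))).
  have WP : W `<=` V /\ in_chart W.
    split; first by move=> z [].
    by exists B, j; split=> // z [_ [t _ <-]]; exists t.
  by exists (exist _ W WP) => //; split=> //; exists y.
pose U i := preim_opens (hom_cont u) (O i).
have UV i : U i `<=` preim_opens (hom_cont u) V by move=> q; exact: OV.
have covU : preim_opens (hom_cont u) V `<=` \bigcup_i U i.
  by move=> q /cov[i _ Oi]; exists i.
have pull_res s i : hom_pull u (O i) (res (OV i) s) = res (UV i) (hom_pull u V s).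
  exact: hom_pull_res.
have inj : injective (hom_pull u V).
  move=> s t st; have [sep _] := lrs_sheaf OV cov; apply: sep => i.
  by apply: in_chart_pull_inj => //; rewrite !pull_res st.
have surj s : exists t, hom_pull u V t = s.
  pose t i := projT1 (cid (in_chart_pull_surj (res (UV i) s) (Oc i))).
  have tE i : hom_pull u (O i) (t i) = res (UV i) s.
    by rewrite /t; case: cid.
  have [_ glue] := lrs_sheaf OV cov.
  have [i k W hi hk|t0 t0E] := glue t.
    have [B [j [jP Oj]]] := Oc i.
    apply: in_chart_pull_inj; first by exists B, j; split=> // x /hi /Oj.
    have hi' : preim_opens (hom_cont u) W `<=` U i by move=> q /hi.
    have hk' : preim_opens (hom_cont u) W `<=` U k by move=> q /hk.
    rewrite (hom_pull_res u hi hi') (hom_pull_res u hk hk') !tE !res_trans.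
    exact: res_irr.
  exists t0; have [sep _] := spec_sheaf UV covU; apply: sep => i.
  by rewrite -[LHS]pull_res t0E tE.
exists (fun s => projT1 (cid (surj s))) => s; last by case: cid.
by apply: inj; case: cid.
Qed.

(** [u] is a surjective open immersion, so the identity of [X] factors through it; monicity makes
    this factor a two-sided inverse. *)
Lemma representable_affine : is_affine X.
Proof.
have hu (x : X) : range u (id_lrs X x).
  have [B [j [jP [y _ <-]]]] := sch_cover x; have [phi phiE] := chart_lift j.
  by exists (comap phi y) => //; exact: chartE.
exists A, (factor universal_open_immersion hu), u.
have uk := factorE universal_open_immersion hu; split=> //.
by apply: universal_monic; rewrite comp_lrsA uk comp_lrs_id id_comp_lrs.
Qed.

End RepresentableAffine.

(** * Transposition and reflexivity *)

Lemma rmod_isoP (R : comPzRingType) (M N : rmodule R) (f : rmod_hom M N) :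
  rmod_iso f <-> forall S, bijective (f S).
Proof.
split=> [[g gP] S|fbij]; first by have [fK gK] := gP S; exists (g S).
have surj S y : exists x, f S x = y by have [g _ gK] := fbij S; exists (g y).
pose g S y := projT1 (cid (surj S y)).
have gE S y : f S (g S y) = y by rewrite /g; case: cid.
have finj S := bij_inj (fbij S).
have gN S T (a : alg_hom S T) y : g T (fmap a y) = fmap a (g S y).
  by apply: finj; rewrite gE rmod_hom_nat gE.
have gD S x y : g S (radd x y) = radd (g S x) (g S y).
  by apply: finj; rewrite gE rmod_homD !gE.
have gZ (S : algebra R) (a : S) x : g S (rscale a x) = rscale a (g S x).
  by apply: finj; rewrite gE rmod_homZ gE.
by exists (RModHom gN gD gZ) => S; split=> x /=; [apply: finj|]; exact: gE.
Qed.

Section RModComp.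
Variables (R : comPzRingType) (M N P : rmodule R).
Variables (g : rmod_hom N P) (f : rmod_hom M N).

Definition rmod_comp : rmod_hom M P.
Proof.
apply: (@RModHom R M P (fun S x => g S (f S x))).
- by move=> S T a x; rewrite !rmod_hom_nat.
- by move=> S x y; rewrite !rmod_homD.
- by move=> S a x; rewrite !rmod_homZ.
Defined.

End RModComp.

Section DualHom.
Variables (R : comPzRingType) (M N : rmodule R) (f : rmod_hom M N).

Definition dual_hom_obj (S : algebra R) (phi : dual_obj N S) : dual_obj M S.
Proof.
apply: (@RModHom S (restr M S) (ring_rmodule S)
  (fun T x => phi T (f (alg_restr T) x))).
- move=> T U a x; rewrite -[RHS](rmod_hom_nat phi a).
  by apply: (rmod_hom_arg phi U); exact: (rmod_hom_nat f (alg_restr_hom a) x).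
- move=> T x y; rewrite -[RHS](rmod_homD phi).
  by apply: (rmod_hom_arg phi T); exact: (@rmod_homD _ _ _ f (alg_restr T) x y).
- move=> T a x; rewrite -[RHS](rmod_homZ phi).
  by apply: (rmod_hom_arg phi T); exact: (@rmod_homZ _ _ _ f (alg_restr T) a x).
Defined.

Definition dual_hom : rmod_hom (dual N) (dual M).
Proof.
apply: (@RModHom R (dual N) (dual M) dual_hom_obj).
- move=> S T a phi; apply: rmod_hom_ext => U x; rewrite /= /dual_map_fun.
  by apply: (rmod_hom_arg phi (alg_pull a U)); rewrite /= rmod_hom_nat.
- by move=> S phi psi; apply: rmod_hom_ext.
- by move=> S a phi; apply: rmod_hom_ext.
Defined.

End DualHom.

Lemma dual_hom_iso (R : comPzRingType) (M N : rmodule R) (f : rmod_hom M N) :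
  rmod_iso f -> rmod_iso (dual_hom f).
Proof.
move=> [g gP]; exists (dual_hom g) => S.
have gK T := (gP T).1; have fK T := (gP T).2.
split=> phi; apply: rmod_hom_ext => T x; apply: (rmod_hom_arg phi T);
  [exact: fK|exact: gK].
Qed.

Section Transpose.
Variables (R : comPzRingType) (F G : rmodule R) (k : rmod_hom F (dual G)).

Definition transpose : rmod_hom G (dual F) :=
  rmod_comp (dual_hom k) (bidual_map G).

(** Both sides send g to (k x)(g): unfolding leaves only base changes, which naturality of [k] and
    of [k x] removes. *)
Lemma transposeK S x : dual_hom transpose S (bidual_map F S x) = k S x.
Proof.
apply: rmod_hom_ext => T g.
pose P := alg_restr (alg_self (alg_restr T)).
pose kx : dual_obj G S := k S x.
transitivity ((k P (fmap (alg_str_hom T) x) : dual_obj G P) (alg_self P)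
  (fmap (alg_str_hom (alg_self (alg_restr T))) g)); first by [].
rewrite (rmod_hom_nat k (alg_str_hom T) x) /= /dual_map_fun -/kx.
pose W := alg_pull (alg_str_hom T) (alg_self P).
pose i : alg_hom T W := @AlgHom S T W idfun (fun r => erefl).
refine (etrans _ (rmod_hom_nat kx i g)).
by apply: (rmod_hom_arg kx W); rewrite /= -fmap_comp; exact: fmap_ext.
Qed.

Lemma reflexive_iff_iso : rmod_iso transpose ->
  reflexive_rmodule F <-> rmod_iso k.
Proof.
move=> /dual_hom_iso /rmod_isoP tbij.
have kE S : k S =1 dual_hom transpose S \o bidual_map F S.
  by move=> x; rewrite [RHS]transposeK.
rewrite /reflexive_rmodule !rmod_isoP; split=> H S.
  by apply: (@eq_bij _ _ (dual_hom transpose S \o bidual_map F S)) => [|x];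
    [exact: bij_comp|rewrite [LHS]transposeK].
have [t tK Kt] := tbij S.
apply: (@eq_bij _ _ (t \o k S)) => [|x]; last by rewrite /= kE /= tK.
by apply: bij_comp => //; exists (dual_hom transpose S).
Qed.

End Transpose.

(** * Tensor products and the dual of a quasi-coherent module *)

Section TensorModule.
Variables (R : comPzRingType) (M : lmodType R) (S : algebra R).

HB.instance Definition _ := gen_eqMixin (tensor M S).
HB.instance Definition _ := gen_choiceMixin (tensor M S).
HB.instance Definition _ := GRing.isZmodule.Build (tensor M S)
  (@tens_addA R M S) (@tens_addC R M S) (@tens_add0 R M S)
  (@tens_scale_addN R M S).

Let str := qc_structure M.

HB.instance Definition _ := GRing.Zmodule_isLmodule.Build S (tensor M S)
  (@mscaleA R _ str S) (@mscale1 R _ str S) (@mscaleDr R _ str S)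
  (fun t a b => @mscaleDl R _ str S a b t).

Lemma tens_cat_add (x y : seq (M * S)) : tens (x ++ y) = tens x + tens y.
Proof. by rewrite -tens_addE. Qed.

Definition pure (m : M) (s : S) : tensor M S := tens [:: (m, s)].

Lemma pureZ m s : pure m s = s *: pure m 1.
Proof. by rewrite /pure [RHS]tens_scaleE /= mulr1. Qed.

Lemma pure_baseZ r m s : pure (r *: m) s = pure m (alg_map S r * s).
Proof. by apply/tensE; exact: tens_Z. Qed.

Lemma pureDl m m' s : pure (m + m') s = pure m s + pure m' s.
Proof.
by rewrite -[RHS](tens_cat_add [:: _] [:: _]); apply/tensE; exact: tens_Dl.
Qed.

Lemma tensor_ind (P : tensor M S -> Prop) :
  P 0 -> (forall m s t, P t -> P (pure m s + t)) -> forall t, P t.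
Proof.
move=> P0 PD t; have [x ->] := tensorP t; elim: x => [//|[m s] x IH].
by rewrite -cat1s tens_cat_add; exact: PD.
Qed.

Section Lift.
Variables (T : comPzRingType) (f : M -> T) (g : S -> T).
Hypotheses (fD : {morph f : m n / m + n}) (gD : {morph g : s t / s + t}).
Hypothesis fg : forall r m s, f (r *: m) * g s = f m * g (alg_map S r * s).

Definition tensor_lift (t : tensor M S) : T :=
  \sum_(ms <- repr t) f ms.1 * g ms.2.

Lemma tensor_liftE x : tensor_lift (tens x) = \sum_(ms <- x) f ms.1 * g ms.2.
Proof.
have f0 : f 0 = 0 by apply: (addrI (f 0)); rewrite -fD !addr0.
suff inv a b : tens_eq a b ->
    \sum_(ms <- a) f ms.1 * g ms.2 = \sum_(ms <- b) f ms.1 * g ms.2.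
  exact/inv/repr_tens.
elim=> {a b x} [y|y z _ ->|x y z _ E _ F|x x' y y' _ E _ F|x y|s|m m' s|m s s'|r m s] //.
- by rewrite E.
- by rewrite !big_cat /= E F.
- by rewrite !big_cat /= addrC.
- by rewrite big_seq1 big_nil f0 mul0r.
- by rewrite !big_cons !big_nil !addr0 fD mulrDl.
- by rewrite !big_cons !big_nil !addr0 gD mulrDr.
- by rewrite !big_seq1 fg.
Qed.

End Lift.

End TensorModule.

Section DualQuasiCoherent.
Variables (R : comPzRingType) (N : lmodType R).
Notation D := (dual (quasi_coherent N)).

(** One half of the identification of N^*(S) with Hom_R(N, S): [dual_qc_ext] gives injectivity,
    [functional] surjectivity. *)
Definition coef (S : algebra R) (phi : D S) (n : N) : S :=
  (phi : dual_obj (quasi_coherent N) S) (alg_self S)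
    (pure n (1 : alg_restr (alg_self S))).

Lemma dual_qc_pure (S : algebra R) (phi : dual_obj (quasi_coherent N) S)
    (T : algebra S) n (t : T) :
  phi T (pure n (t : alg_restr T)) = t * alg_map T (coef phi n).
Proof.
pose i : alg_hom (alg_self S) T := @AlgHom S (alg_self S) T (alg_map T) (fun r => erefl).
pose p : restr (quasi_coherent N) S (alg_self S) := pure n 1.
have <- : phi T (fmap i p) = alg_map T (coef phi n) := rmod_hom_nat phi i p.
rewrite -[RHS](@rmod_homZ _ _ _ phi T t); apply: (rmod_hom_arg phi T).
by rewrite /rscale /= /pure tens_mapE tens_scaleE /= rmorph1 mulr1.
Qed.

Lemma dual_qc0 (S : algebra R) (phi : dual_obj (quasi_coherent N) S)
    (T : algebra S) : phi T (0 : tensor N (alg_restr T)) = (0 : T).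
Proof.
have := @rmod_homZ _ _ _ phi T 0 (0 : tensor N (alg_restr T)).
by rewrite /rscale /= mul0r tens_scale0.
Qed.

Lemma dual_qc_ext (S : algebra R) (phi psi : D S) :
  coef phi =1 coef psi -> phi = psi.
Proof.
move=> E; apply: rmod_hom_ext => T; elim/tensor_ind => [|m s t IH].
  by rewrite [LHS]dual_qc0 [RHS]dual_qc0.
rewrite [LHS](@rmod_homD _ _ _ phi T) [RHS](@rmod_homD _ _ _ psi T).
by rewrite [X in radd X _]dual_qc_pure [X in _ = radd X _]dual_qc_pure E IH.
Qed.

Lemma coefD (S : algebra R) (phi psi : D S) n :
  coef (radd phi psi) n = coef phi n + coef psi n.
Proof. by []. Qed.

Lemma coefZ (S : algebra R) (s : S) (phi : D S) n :
  coef (rscale s phi) n = s * coef phi n.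
Proof. by []. Qed.

Lemma coef_fmap (S T : algebra R) (f : alg_hom S T) (phi : D S) n :
  coef (fmap f phi) n = f (coef phi n).
Proof.
pose U := alg_pull f (alg_self T); pose p : quasi_coherent N (alg_restr U) := pure n 1.
transitivity ((phi : dual_obj (quasi_coherent N) S) U p).
  apply: (rmod_hom_arg (phi : dual_obj (quasi_coherent N) S) U).
  by rewrite /p /pure /= tens_mapE.
by rewrite [LHS]dual_qc_pure mul1r.
Qed.

Lemma coef_linD (S : algebra R) (phi : D S) m n :
  coef phi (m + n) = coef phi m + coef phi n.
Proof.
rewrite /coef pureDl.
exact: (@rmod_homD _ _ _ (phi : dual_obj (quasi_coherent N) S) (alg_self S)).
Qed.

Lemma coef_linZ (S : algebra R) (phi : D S) r n :
  coef phi (r *: n) = alg_map S r * coef phi n.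
Proof.
rewrite /coef pure_baseZ pureZ mulr1.
exact: (@rmod_homZ _ _ _ (phi : dual_obj (quasi_coherent N) S) (alg_self S)).
Qed.

Section Functional.
Variables (S : algebra R) (l : N -> S).
Hypotheses (lD : {morph l : m n / m + n}).
Hypothesis lZ : forall r n, l (r *: n) = alg_map S r * l n.

Definition functional_val (T : algebra S) (t : tensor N (alg_restr T)) : T :=
  tensor_lift (fun n => alg_map T (l n)) (fun s : alg_restr T => s : T) t.

Lemma functional_valE T (x : seq (N * alg_restr T)) :
  functional_val (tens x) = \sum_(ns <- x) alg_map T (l ns.1) * ns.2.
Proof.
apply: tensor_liftE => // [m n|r m s]; first by rewrite lD rmorphD.
by rewrite lZ rmorphM /= -mulrA mulrCA.
Qed.

Definition functional : D S.
Proof.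
apply: (@RModHom S (restr (quasi_coherent N) S) (ring_rmodule S) functional_val).
- move=> T U f t; have [x ->] := tensorP t.
  rewrite /= tens_mapE !functional_valE big_map rmorph_sum.
  by apply: eq_bigr => ns _; rewrite /= rmorphM alg_homP.
- move=> T t u; have [x ->] := tensorP t; have [y ->] := tensorP u.
  by rewrite /radd /= tens_addE !functional_valE big_cat.
- move=> T a t; have [x ->] := tensorP t.
  rewrite /rscale /= tens_scaleE !functional_valE big_map mulr_sumr.
  by apply: eq_bigr => ns _; rewrite /= mulrCA.
Defined.

Lemma coef_functional n : coef functional n = l n.
Proof.
by rewrite /coef /pure [LHS]functional_valE big_seq1 /= mulr1.
Qed.

End Functional.

Section TransposePure.
Variables (F : rmodule R) (k : rmod_hom F D).

Lemma transpose_pure (S : algebra R) (T : algebra S) (y : F (alg_restr T)) n s :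
  (transpose k S (pure n s) : dual_obj F S) T y =
  alg_map T s * coef (k (alg_restr T) y) n.
Proof.
pose U := alg_self (alg_restr T).
pose ky : dual_obj (quasi_coherent N) (alg_restr T) := k (alg_restr T) y.
pose p : quasi_coherent N (alg_restr U) :=
  pure n (alg_map T s : alg_restr U).
transitivity (ky U p); last by rewrite [LHS]dual_qc_pure.
by apply: (rmod_hom_arg ky U); rewrite /p /pure /= tens_mapE.
Qed.

End TransposePure.

End DualQuasiCoherent.

(** * Square-zero extensions *)

Section SquareZero.
Variables (S : comPzRingType) (V : lmodType S).

Record sqz := Sqz { sq0 : S; sq1 : V }.

HB.instance Definition _ := gen_eqMixin sqz.
HB.instance Definition _ := gen_choiceMixin sqz.

Definition sqz_add x y := Sqz (sq0 x + sq0 y) (sq1 x + sq1 y).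
Definition sqz_opp x := Sqz (- sq0 x) (- sq1 x).
Definition sqz_mul x y := Sqz (sq0 x * sq0 y) (sq0 x *: sq1 y + sq0 y *: sq1 x).

Lemma sqz_addA : associative sqz_add.
Proof. by move=> x y z; rewrite /sqz_add /= !addrA. Qed.
Lemma sqz_addC : commutative sqz_add.
Proof. by move=> x y; rewrite /sqz_add addrC [sq1 _ + _]addrC. Qed.
Lemma sqz_add0 : left_id (Sqz 0 0) sqz_add.
Proof. by case=> a v; rewrite /sqz_add /= !add0r. Qed.
Lemma sqz_addN : left_inverse (Sqz 0 0) sqz_opp sqz_add.
Proof. by case=> a v; rewrite /sqz_add /= !addNr. Qed.
Lemma sqz_mulA : associative sqz_mul.
Proof.
case=> a u [b v] [c w]; rewrite /sqz_mul /= mulrA !scalerDr !scalerA -!addrA.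
by rewrite [c * a]mulrC [c * b]mulrC (mulrC b c).
Qed.
Lemma sqz_mulC : commutative sqz_mul.
Proof. by move=> x y; rewrite /sqz_mul mulrC addrC. Qed.
Lemma sqz_mul1 : left_id (Sqz 1 0) sqz_mul.
Proof. by case=> a v; rewrite /sqz_mul /= mul1r scale1r scaler0 addr0. Qed.
Lemma sqz_mulDl : left_distributive sqz_mul sqz_add.
Proof.
case=> a u [b v] [c w]; rewrite /sqz_mul /sqz_add /= mulrDl scalerDl scalerDr.
by rewrite addrACA.
Qed.

HB.instance Definition _ := GRing.isZmodule.Build sqz
  sqz_addA sqz_addC sqz_add0 sqz_addN.
HB.instance Definition _ := GRing.Zmodule_isComPzRing.Build sqz
  sqz_mulA sqz_mulC sqz_mul1 sqz_mulDl.

Lemma sqz_eta x : x = Sqz (sq0 x) (sq1 x). Proof. by case: x. Qed.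

Lemma SqzD a b u v : Sqz a u + Sqz b v = Sqz (a + b) (u + v). Proof. by []. Qed.
Lemma SqzM a b u v : Sqz a u * Sqz b v = Sqz (a * b) (a *: v + b *: u).
Proof. by []. Qed.
Lemma Sqz1 : Sqz 1 0 = 1. Proof. by []. Qed.
Lemma Sqz0 : Sqz 0 0 = 0. Proof. by []. Qed.

Lemma sqz_inclD : {morph Sqz^~ 0 : a b / a + b}.
Proof. by move=> a b; rewrite SqzD addr0. Qed.
Lemma sqz_inclM : {morph Sqz^~ 0 : a b / a * b}.
Proof. by move=> a b; rewrite SqzM !scaler0 addr0. Qed.

Definition sqz_incl : {rmorphism S -> sqz} := mk_rmorphism sqz_inclD Sqz1 sqz_inclM.

Definition sqz_alg : algebra S := @Algebra S sqz sqz_incl.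

Section Lift.
Variables (T : comPzRingType) (f : {rmorphism S -> T}) (l : V -> T).
Hypotheses (lD : {morph l : u v / u + v}) (lZ : forall a v, l (a *: v) = f a * l v).
Hypothesis l2 : forall u v, l u * l v = 0.

Definition sqz_lift_fun x := f (sq0 x) + l (sq1 x).

Let l0 : l 0 = 0. Proof. by apply: (addrI (l 0)); rewrite -lD !addr0. Qed.

Lemma sqz_liftD : {morph sqz_lift_fun : x y / x + y}.
Proof. by move=> x y; rewrite /sqz_lift_fun rmorphD lD addrACA. Qed.
Lemma sqz_lift1 : sqz_lift_fun 1 = 1.
Proof. by rewrite /sqz_lift_fun rmorph1 l0 addr0. Qed.
Lemma sqz_liftM : {morph sqz_lift_fun : x y / x * y}.
Proof.
case=> a u [b v]; rewrite SqzM /sqz_lift_fun /= rmorphM lD !lZ mulrDl !mulrDr l2 addr0.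
by rewrite -addrA [l u * _]mulrC.
Qed.

Definition sqz_lift : {rmorphism sqz -> T} :=
  mk_rmorphism sqz_liftD sqz_lift1 sqz_liftM.

Lemma sqz_liftE x : sqz_lift x = f (sq0 x) + l (sq1 x). Proof. by []. Qed.

End Lift.

End SquareZero.

Section DualNumbers.
Variables (R : comPzRingType) (S : algebra R).

Definition dual_numbers : algebra R := @Algebra R (sqz S^o) (sqz_incl S^o \o alg_map S).

Definition to_dual_numbers : alg_hom S dual_numbers :=
  @AlgHom R S dual_numbers (sqz_incl S^o) (fun r => erefl).

Definition eps : dual_numbers := @Sqz S S^o 0 1.

Lemma eps_mul (a : S) : eps * to_dual_numbers a = @Sqz S S^o 0 a.
Proof. rewrite /eps /= SqzM mul0r scaler0 add0r; congr Sqz; exact: mulr1. Qed.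

End DualNumbers.

(** * A criterion for the transpose to be an isomorphism *)

Section UniversalTransposition.
Variables (R : comPzRingType) (N : lmodType R) (F : rmodule R).
Variable k : rmod_hom F (dual (quasi_coherent N)).

Section Lift.
Variables (S : algebra R) (T : algebra S) (y : F (alg_restr T)).

Definition pairing (t : tensor N S) : T := (transpose k S t : dual_obj F S) T y.

Definition eps_pairing (t : tensor N S) : dual_numbers T := @Sqz T T^o 0 (pairing t).

Lemma eps_pairingD : {morph eps_pairing : t u / t + u}.
Proof.
move=> t u; rewrite /eps_pairing /pairing SqzD addr0; congr (Sqz _ _).
by rewrite (@rmod_homD _ _ _ (transpose k) S t u).
Qed.

Lemma eps_pairingZ (a : S) (t : tensor N S) :
  eps_pairing (a *: t) = alg_map (dual_numbers T) a * eps_pairing t.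
Proof.
rewrite /eps_pairing /pairing /= SqzM mulr0 scaler0 addr0; congr (Sqz _ _).
exact: (congr1 (fun p : dual_obj F S => p T y)
  (@rmod_homZ _ _ _ (transpose k) S a t)).
Qed.

Lemma eps_pairing2 t u : eps_pairing t * eps_pairing u = 0.
Proof. by rewrite SqzM mul0r !scale0r addr0. Qed.

Let f : {rmorphism sqz (tensor N S) -> dual_numbers T} :=
  sqz_lift eps_pairingD eps_pairingZ eps_pairing2.

Let fP (a : S) : f (alg_map (sqz_alg (tensor N S)) a) = alg_map (dual_numbers T) a.
Proof.
rewrite /f sqz_liftE /=; suff -> : eps_pairing 0 = 0 by rewrite addr0.
by apply: (addrI (eps_pairing 0)); rewrite -eps_pairingD !addr0.
Qed.

Definition pairing_hom : alg_hom (sqz_alg (tensor N S)) (dual_numbers T) :=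
  @AlgHom S (sqz_alg (tensor N S)) (dual_numbers T) f fP.

Lemma pairing_homE a t : pairing_hom (Sqz a t) = @Sqz T T^o (alg_map T a) (pairing t).
Proof. by rewrite -[LHS]/(f _) sqz_liftE /= SqzD addr0 add0r. Qed.

End Lift.

(* A point x S of F over S (+) (N (x) S) whose image under k is n |-> n (x) 1, *)
(* and from which every eps * y arises by base change.                         *)
Variable x : forall S : algebra R, F (alg_restr (sqz_alg (tensor N S))).
Hypothesis coef_x : forall (S : algebra R) n,
  coef (k _ (x S)) n = Sqz 0 (pure n (1 : S)).
Hypothesis x_eps : forall (S : algebra R) (T : algebra S) (y : F (alg_restr T)),
  fmap (alg_restr_hom (pairing_hom y)) (x S) =
  @rscale R F (alg_restr (dual_numbers T)) (eps T)
    (fmap (alg_restr_hom (to_dual_numbers T)) y).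

(** On pure tensors this is [coef_x]. It recovers t from its transpose, which gives injectivity. *)
Lemma pairing_x (S : algebra R) (t : tensor N S) : pairing (x S) t = Sqz 0 t.
Proof.
have pD u v : pairing (x S) (u + v) = pairing (x S) u + pairing (x S) v.
  by rewrite /pairing (@rmod_homD _ _ _ (transpose k) S u v).
elim/tensor_ind: t => [|n s t IH].
  by apply: (addrI (pairing (x S) 0)); rewrite -pD !addr0.
rewrite pD IH /pairing transpose_pure coef_x /= SqzM SqzD mulr0 scale0r !addr0.
by rewrite -pureZ.
Qed.

Lemma transpose_iso : rmod_iso (transpose k).
Proof.
apply/rmod_isoP => S.
have inj : injective (transpose k S).
  move=> t u E; suff : Sqz (0 : S) t = Sqz 0 u by case.
  by rewrite -!pairing_x /pairing E.
have surj (phi : dual F S) : exists t, transpose k S t = phi.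
  pose phi' : dual_obj F S := phi.
  pose E := sqz_alg (tensor N S).
  (* By naturality [pairing_hom y] sends phi(x S) to phi(eps y) = eps phi(y); comparing the
     eps-components shows that phi(y) is the pairing of y with this element. *)
  exists (sq1 (phi' E (x S) : sqz (tensor N S))).
  apply: rmod_hom_ext => T y; rewrite -[LHS]/(pairing y _).
  pose TE := dual_numbers T.
  have e1 : phi' TE (fmap (alg_restr_hom (pairing_hom y)) (x S)) =
      pairing_hom y (phi' E (x S)) := rmod_hom_nat phi' (pairing_hom y) (x S).
  have e2 : phi' TE (fmap (alg_restr_hom (to_dual_numbers T)) y) =
      to_dual_numbers T (phi' T y) := rmod_hom_nat phi' (to_dual_numbers T) y.
  move: e1; rewrite x_eps [LHS](@rmod_homZ _ _ _ phi' TE).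
  rewrite [X in rscale _ X]e2 /rscale [LHS]eps_mul [phi' E _]sqz_eta pairing_homE.
  by case=> _ ->.
exists (fun phi => projT1 (cid (surj phi))) => phi; last by case: cid.
by apply: inj; case: cid.
Qed.

End UniversalTransposition.

(** * Linear functions on a representable module *)

Section FixedSubmodule.
Variables (R : comPzRingType) (A : algebra R).

Record endomorphism := Endomorphism {
  endo_fun :> A -> A;
  endoD : {morph endo_fun : a b / a + b};
  endoZ : forall r a, endo_fun (alg_map A r * a) = alg_map A r * endo_fun a }.

Variable pi : endomorphism.

(** Used for the projector [linear_part], whose image is its set of fixed elements. *)
Record fixed := Fixed { fixed_val : A; fixedP : pi fixed_val = fixed_val }.

HB.instance Definition _ := gen_eqMixin fixed.
HB.instance Definition _ := gen_choiceMixin fixed.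

Lemma fixed_inj : injective fixed_val.
Proof.
by case=> a aP [b bP] /= e; subst b; rewrite (Prop_irrelevance aP bP).
Qed.

Lemma fixed0_subproof : pi 0 = 0.
Proof. by apply: (addrI (pi 0)); rewrite -endoD !addr0. Qed.

Lemma fixedN_subproof (a : fixed) : pi (- fixed_val a) = - fixed_val a.
Proof.
by apply: (addrI (pi (fixed_val a))); rewrite -endoD subrr fixed0_subproof fixedP subrr.
Qed.

Lemma fixedD_subproof (a b : fixed) : 
  pi (fixed_val a + fixed_val b) = fixed_val a + fixed_val b.
Proof. by rewrite endoD !fixedP. Qed.

Lemma fixedZ_subproof r (a : fixed) : 
  pi (alg_map A r * fixed_val a) = alg_map A r * fixed_val a.
Proof. by rewrite endoZ fixedP. Qed.

Definition fixed_add a b := Fixed (fixedD_subproof a b).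
Definition fixed_scale r a := Fixed (fixedZ_subproof r a).

Lemma fixed_addA : associative fixed_add.
Proof. by move=> a b c; apply: fixed_inj; rewrite /= addrA. Qed.
Lemma fixed_addC : commutative fixed_add.
Proof. by move=> a b; apply: fixed_inj; rewrite /= addrC. Qed.
Lemma fixed_add0 : left_id (Fixed fixed0_subproof) fixed_add.
Proof. by move=> a; apply: fixed_inj; rewrite /= add0r. Qed.
Lemma fixed_addN :
  left_inverse (Fixed fixed0_subproof) (fun a => Fixed (fixedN_subproof a)) fixed_add.
Proof. by move=> a; apply: fixed_inj; rewrite /= addNr. Qed.

HB.instance Definition _ := GRing.isZmodule.Build fixed
  fixed_addA fixed_addC fixed_add0 fixed_addN.

Lemma fixed_scaleA r s a : fixed_scale r (fixed_scale s a) = fixed_scale (r * s) a.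
Proof. by apply: fixed_inj; rewrite /= rmorphM mulrA. Qed.
Lemma fixed_scale1 : left_id 1 fixed_scale.
Proof. by move=> a; apply: fixed_inj; rewrite /= rmorph1 mul1r. Qed.
Lemma fixed_scaleDr : right_distributive fixed_scale +%R.
Proof. by move=> r a b; apply: fixed_inj; rewrite /= mulrDr. Qed.
Lemma fixed_scaleDl a : {morph fixed_scale^~ a : r s / r + s}.
Proof. by move=> r s; apply: fixed_inj; rewrite /= rmorphD mulrDl. Qed.

HB.instance Definition _ := GRing.Zmodule_isLmodule.Build R fixed
  fixed_scaleA fixed_scale1 fixed_scaleDr fixed_scaleDl.

Lemma fixed_valD (a b : fixed) : 
  fixed_val (a + b) = fixed_val a + fixed_val b.
Proof. by []. Qed.

Lemma fixed_valZ r (a : fixed) : 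
  fixed_val (r *: a) = alg_map A r * fixed_val a.
Proof. by []. Qed.

End FixedSubmodule.

Section RModuleTheory.
Variables (R : comPzRingType) (F : rmodule R).

Definition rzero (S : algebra R) : F S := mzero (rmod_str F) S.

Lemma raddA (S : algebra R) : associative (@radd R F S).
Proof. exact: maddA. Qed.

Lemma radd0 (S : algebra R) : right_id (rzero S) (@radd R F S).
Proof. by move=> x; rewrite [LHS]maddC [LHS]madd0. Qed.

Lemma rscaleA (S : algebra R) (a b : S) (x : F S) :
  rscale a (rscale b x) = rscale (a * b) x.
Proof. exact: mscaleA. Qed.

Lemma rscale0 (S : algebra R) (x : F S) : rscale 0 x = rzero S.
Proof.
pose n := mopp (rmod_str F) (rscale (0 : S) x).
have nK : radd n (rscale 0 x) = rzero S by exact: maddN.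
have e : radd (rscale 0 x) (rscale 0 x) = rscale (0 : S) x.
  by rewrite -[LHS](mscaleDl (rmod_str F)) addr0.
rewrite -[LHS](madd0 (rmod_str F)) -[mzero _ _]nK -[LHS]raddA.
exact: (etrans (congr1 (radd n) e) nK).
Qed.

Lemma fmap_rscale (S T : algebra R) (f : alg_hom S T) (a : S) (x : F S) :
  fmap f (rscale a x) = rscale (f a) (fmap f x).
Proof. exact: fmap_mscale. Qed.

Lemma fmap_radd (S T : algebra R) (f : alg_hom S T) (x y : F S) :
  fmap f (radd x y) = radd (fmap f x) (fmap f y).
Proof. exact: fmap_madd. Qed.

Lemma fmap_rzero (S T : algebra R) (f : alg_hom S T) : fmap f (rzero S) = rzero T.
Proof. by rewrite -(rscale0 (rzero S)) fmap_rscale rmorph0 rscale0. Qed.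

End RModuleTheory.

Section RepresentableTranspose.
Variables (R : comPzRingType) (F : rmodule R) (A : algebra R) (u : F A).
Hypothesis uP : represents u.

(** Elements of [A] are the functions on [F]: [classify y a] is the value a(y). *)
Definition classify (S : algebra R) (y : F S) : alg_hom A S := projT1 (cid (uP y)).

Lemma classifyE (S : algebra R) (y : F S) : fmap (classify y) u = y.
Proof. by rewrite /classify; case: cid => f []. Qed.

Lemma classify_uniq (S : algebra R) (y : F S) (f : alg_hom A S) :
  fmap f u = y -> classify y = f.
Proof. by move=> fE; apply: (represents_inj uP); rewrite classifyE fE. Qed.

Lemma classify_ext (S : algebra R) (x y : F S) : classify x =1 classify y -> x = y.
Proof. by move=> /alg_hom_ext E; rewrite -[x]classifyE E classifyE. Qed.

Lemma classify_fmap (S T : algebra R) (f : alg_hom S T) (y : F S) a :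
  classify (fmap f y) a = f (classify y a).
Proof.
rewrite (@classify_uniq _ _ (alg_comp f (classify y))) //.
by rewrite fmap_comp classifyE.
Qed.

Definition value0 (a : A) : R := classify (rzero F (alg_self R)) a.

Lemma value0E (S : algebra R) a : classify (rzero F S) a = alg_map S (value0 a).
Proof.
pose i : alg_hom (alg_self R) S := @AlgHom R (alg_self R) S (alg_map S) (fun r => erefl).
by rewrite -(fmap_rzero F i) classify_fmap.
Qed.

Lemma value0D : {morph value0 : a b / a + b}.
Proof. by move=> a b; rewrite /value0 rmorphD. Qed.
Lemma value0M : {morph value0 : a b / a * b}.
Proof. by move=> a b; rewrite /value0 rmorphM. Qed.
Lemma value0Z r : value0 (alg_map A r) = r.
Proof. by rewrite /value0 alg_homP. Qed.

Definition eps_point (S : algebra R) (y : F S) : F (dual_numbers S) :=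
  rscale (eps S) (fmap (to_dual_numbers S) y).

(* The differential of a along the zero section, in the direction u *)
Definition linear_part (a : A) : A := sq1 (classify (eps_point u) a).

(** Setting eps = 0 sends eps u to the zero point. *)
Lemma sq0_linear_part a : sq0 (classify (eps_point u) a) = alg_map A (value0 a).
Proof.
pose p : {rmorphism sqz A^o -> A} :=
  mk_rmorphism (fun x y => erefl : sq0 (x + y) = sq0 x + sq0 y)
    (erefl : sq0 (1 : sqz A^o) = 1)
    (fun x y => erefl : sq0 (x * y) = sq0 x * sq0 y).
pose p' : alg_hom (dual_numbers A) A := @AlgHom R (dual_numbers A) A p (fun r => erefl).
rewrite -[LHS]/(p' _) -classify_fmap fmap_rscale.
by rewrite [X in rscale X _](_ : _ = 0) // rscale0 value0E.
Qed.

Lemma classify_eps_point a :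
  classify (eps_point u) a = @Sqz A A^o (alg_map A (value0 a)) (linear_part a).
Proof. by rewrite [LHS]sqz_eta sq0_linear_part. Qed.

Section Nilpotent.
Variables (S : algebra R) (e : S) (y : F S).
Hypothesis e2 : e * e = 0.

Let l (b : A^o) : S := e * classify y b.

Let lD : {morph l : b c / b + c}.
Proof. by move=> b c; rewrite /l rmorphD mulrDr. Qed.

Let lZ (a : A) (b : A^o) : l (a *: b) = classify y a * l b.
Proof. by rewrite /l [a *: b]/(a * b) rmorphM mulrCA. Qed.

Let l2 b c : l b * l c = 0.
Proof. by rewrite /l mulrACA e2 mul0r. Qed.

Let gP r : sqz_lift lD lZ l2 (alg_map (dual_numbers A) r) = alg_map S r.
Proof.
rewrite -[LHS]/(classify y (alg_map A r) + e * classify y 0).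
by rewrite rmorph0 mulr0 addr0 alg_homP.
Qed.

Let g : alg_hom (dual_numbers A) S :=
  @AlgHom R (dual_numbers A) S (sqz_lift lD lZ l2) gP.

Let gE a b : g (@Sqz A A^o a b) = classify y a + e * classify y b.
Proof. by []. Qed.

(** First-order expansion at zero: e y is the image of eps u under a + eps b |-> a(y) + e b(y),
    which is multiplicative because e^2 = 0. *)
Lemma classify_nilpotent a :
  classify (rscale e y) a = alg_map S (value0 a) + e * classify y (linear_part a).
Proof.
have -> : rscale e y = fmap g (eps_point u).
  rewrite fmap_rscale -fmap_comp.
  have -> : g (eps A) = e.
    by rewrite gE rmorph0 add0r rmorph1 mulr1.
  congr (rscale e _); rewrite -{1}[y]classifyE; apply: fmap_ext => b.
  by rewrite [RHS]gE rmorph0 mulr0 addr0.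
by rewrite classify_fmap classify_eps_point gE alg_homP.
Qed.

End Nilpotent.

Lemma classify_eps (S : algebra R) (y : F S) a :
  classify (eps_point y) a =
  @Sqz S S^o (alg_map S (value0 a)) (classify y (linear_part a)).
Proof.
rewrite classify_nilpotent; last by rewrite /eps SqzM mul0r !scale0r addr0.
by rewrite classify_fmap eps_mul /= SqzD addr0 add0r.
Qed.

(** Write pi for [linear_part] and expand a at eps' (eps u) = (eps' eps) u in two ways. The
    coefficient of eps' is (pi a)(eps u) = (pi a)(0) + eps pi(pi a) in the first, eps pi a in the
    second. *)
Lemma linear_part_idem a :
  linear_part (linear_part a) = linear_part a /\ value0 (linear_part a) = 0.
Proof.
pose D := dual_numbers A.
pose v := fmap (to_dual_numbers D) (fmap (to_dual_numbers A) u).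
pose e : dual_numbers D := @Sqz D D^o 0 (eps A).
have E : eps_point (eps_point u) = rscale e v.
  by rewrite /eps_point fmap_rscale rscaleA eps_mul.
have : classify (eps_point (eps_point u)) a = classify (rscale e v) a by rewrite E.
rewrite classify_eps classify_nilpotent; last first.
  by rewrite /e SqzM mul0r !scale0r addr0.
rewrite !classify_fmap (_ : classify u _ = linear_part a); last first.
  by rewrite (@classify_uniq _ u (alg_id A)) // fmap_id.
rewrite classify_eps_point /= SqzM SqzD => /(congr1 (@sq1 _ _)) /=.
rewrite scaler0 !add0r => H.
(* The first components only show that (pi a)(0) becomes zero in [A]; [value0] retracts the
   structure map, so it is zero in [R]. *)
have [/(congr1 value0)] :=
  etrans H (etrans (mulrC _ _) (eps_mul (linear_part a))).
rewrite value0Z => -> ->; split=> //.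
by rewrite /value0 rmorph0.
Qed.

Lemma linear_partD : {morph linear_part : a b / a + b}.
Proof. by move=> a b; rewrite /linear_part rmorphD. Qed.

(** The Leibniz rule along the zero section, which makes [universal_point_hom] multiplicative. *)
Lemma linear_partM a b : linear_part (a * b) =
  alg_map A (value0 a) * linear_part b + alg_map A (value0 b) * linear_part a.
Proof. by rewrite {1}/linear_part rmorphM !classify_eps_point SqzM. Qed.

Lemma linear_part_base r : linear_part (alg_map A r) = 0.
Proof. by rewrite /linear_part alg_homP. Qed.

Lemma linear_partZ r a : linear_part (alg_map A r * a) = alg_map A r * linear_part a.
Proof. by rewrite linear_partM linear_part_base mulr0 addr0 value0Z. Qed.

Definition linear_forms : lmodType R :=
  fixed (Endomorphism linear_partD linear_partZ).

Definition linear_form_of (a : A) : linear_forms :=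
  @Fixed _ _ (Endomorphism linear_partD linear_partZ) (linear_part a)
    (linear_part_idem a).1.

(** Expand a at eps (s y) = (eps s) y, where eps and eps s both have square zero. *)
Lemma value_scale (S : algebra R) (s : S) (y : F S) a :
  classify (rscale s y) (linear_part a) = s * classify y (linear_part a).
Proof.
pose se : dual_numbers S := @Sqz S S^o 0 s.
have E : eps_point (rscale s y) = rscale se (fmap (to_dual_numbers S) y).
  by rewrite /eps_point fmap_rscale rscaleA eps_mul.
have : classify (eps_point (rscale s y)) a =
    classify (rscale se (fmap (to_dual_numbers S) y)) a by rewrite E.
rewrite classify_eps (@classify_nilpotent _ se); last first.
  by rewrite /se SqzM mul0r !scale0r addr0.
rewrite classify_fmap /se /= SqzM SqzD => /(congr1 (@sq1 _ _)) /= ->.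
by rewrite scaler0 !add0r [LHS]mulrC.
Qed.

Section Additivity.
Variables (S : algebra R) (x y : F S).

Let V : lmodType S := (S^o * S^o)%type.
Let W : algebra R := alg_restr (sqz_alg V).

Let incl : alg_hom S W := @AlgHom R S W (sqz_incl V) (fun r => erefl).
Let w : F W :=
  radd (rscale (@Sqz S V 0 (1, 0) : W) (fmap incl x))
       (rscale (@Sqz S V 0 (0, 1) : W) (fmap incl y)).

Section Projection.
Variables (p : V -> S^o) (pD : {morph p : v v' / v + v'}).
Hypothesis pZ : forall a v, p (a *: v) = a *: p v.

Let h (v : sqz V) : dual_numbers S := @Sqz S S^o (sq0 v) (p (sq1 v)).

Let hD : {morph h : v v' / v + v'}.
Proof. by move=> v v'; rewrite /h SqzD /= pD. Qed.
Let h1 : h 1 = 1.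
Proof. by rewrite /h /=; congr Sqz; rewrite -(scale0r (0 : V)) pZ scale0r. Qed.
Let hM : {morph h : v v' / v * v'}.
Proof. by move=> v v'; rewrite /h SqzM /= pD !pZ. Qed.
Let hP r : mk_rmorphism hD h1 hM (alg_map W r) = alg_map (dual_numbers S) r.
Proof. by rewrite /= /h /=; congr Sqz; rewrite -(scale0r (0 : V)) pZ scale0r. Qed.

Definition sqz_proj : alg_hom W (dual_numbers S) :=
  @AlgHom R W (dual_numbers S) (mk_rmorphism hD h1 hM) hP.

Lemma sqz_projE a v : sqz_proj (Sqz a v) = @Sqz S S^o a (p v).
Proof. by []. Qed.

Lemma fmap_sqz_proj : fmap sqz_proj w =
  radd (rscale (@Sqz S S^o 0 (p (1, 0)) : dual_numbers S) (fmap (to_dual_numbers S) x))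
       (rscale (@Sqz S S^o 0 (p (0, 1)) : dual_numbers S) (fmap (to_dual_numbers S) y)).
Proof.
have e z : fmap sqz_proj (fmap incl z) = fmap (to_dual_numbers S) z.
  rewrite -fmap_comp; apply: fmap_ext => a; rewrite [LHS]sqz_projE.
  by congr Sqz; rewrite -(scale0r (0 : V)) pZ scale0r.
by rewrite fmap_radd !fmap_rscale !e.
Qed.

End Projection.

(** The point w = eps1 x + eps2 y, all products of eps1 and eps2 being zero, specializes to eps x,
    eps y and eps (x + y) under the projections v1, v2 and v1 + v2. The square-zero component of
    a(w) thus determines all three values. *)
Lemma value_add a :
  classify (radd x y) (linear_part a) =
  classify x (linear_part a) + classify y (linear_part a).
Proof.
have fstD : {morph (fst : V -> S^o) : v v' / v + v'} by [].
have sndD : {morph (snd : V -> S^o) : v v' / v + v'} by [].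
have addD : {morph ((fun v => v.1 + v.2) : V -> S^o) : v v' / v + v'}.
  by move=> v v'; rewrite addrACA.
have fstZ s (v : V) : (fst : V -> S^o) (s *: v) = s *: v.1 by [].
have sndZ s (v : V) : (snd : V -> S^o) (s *: v) = s *: v.2 by [].
have addZ s (v : V) : (s *: v).1 + (s *: v).2 = s *: (v.1 + v.2) :> S^o.
  by rewrite scalerDr.
have e1 : fmap (sqz_proj fstD fstZ) w = eps_point x.
  by rewrite fmap_sqz_proj /= [Sqz 0 0]Sqz0 rscale0 radd0.
have e2 : fmap (sqz_proj sndD sndZ) w = eps_point y.
  by rewrite fmap_sqz_proj /= [Sqz 0 0]Sqz0 rscale0 [LHS]madd0.
have e12 : fmap (sqz_proj addD addZ) w = eps_point (radd x y).
  rewrite fmap_sqz_proj /= addr0 add0r /eps_point fmap_radd.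
  by rewrite [RHS](mscaleDr (rmod_str F)).
have key p (pD : {morph p : v v' / v + v'})
    (pZ : forall a v, p (a *: v) = a *: p v) z :
    fmap (@sqz_proj p pD pZ) w = eps_point z ->
    p (sq1 (classify w a)) = classify z (linear_part a).
  move=> /(congr1 (fun t : F (dual_numbers S) => sq1 (classify t a : sqz S^o))).
  by rewrite classify_fmap classify_eps /=.
by rewrite -(key _ _ _ _ e1) -(key _ _ _ _ e2) -(key _ _ _ _ e12).
Qed.

End Additivity.

Lemma value_linear_form (n : linear_forms) : linear_part (fixed_val n) = fixed_val n.
Proof. exact: (fixedP n). Qed.

Definition evaluate_obj (S : algebra R) (y : F S) : dual (quasi_coherent linear_forms) S.
Proof.
apply: (@functional _ _ _ (fun n => classify y (fixed_val n))).
- by move=> m n; rewrite fixed_valD rmorphD.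
- by move=> r n; rewrite fixed_valZ rmorphM alg_homP.
Defined.

Lemma coef_evaluate (S : algebra R) (y : F S) n :
  coef (evaluate_obj y) n = classify y (fixed_val n).
Proof. exact: coef_functional. Qed.

Definition evaluate : rmod_hom F (dual (quasi_coherent linear_forms)).
Proof.
apply: (@RModHom R F (dual (quasi_coherent linear_forms)) evaluate_obj).
- move=> S T f y; apply: dual_qc_ext => n.
  by rewrite coef_fmap !coef_evaluate classify_fmap.
- move=> S x y; apply: dual_qc_ext => n.
  by rewrite coefD !coef_evaluate -value_linear_form value_add.
- move=> S s y; apply: dual_qc_ext => n.
  by rewrite coefZ !coef_evaluate -value_linear_form value_scale.
Defined.

Section UniversalPoint.
Variable S : algebra R.

Let E : algebra R := alg_restr (sqz_alg (tensor linear_forms S)).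

Let h (a : A) : sqz (tensor linear_forms S) :=
  Sqz (alg_map S (value0 a)) (pure (linear_form_of a) (1 : S)).

Let hD : {morph h : a b / a + b}.
Proof.
move=> a b; rewrite /h SqzD value0D rmorphD -pureDl; congr (Sqz _ (pure _ _)).
by apply: fixed_inj; exact: linear_partD.
Qed.

Let pure0 : pure (0 : linear_forms) (1 : S) = 0.
Proof. by rewrite -(scale0r (0 : linear_forms)) pure_baseZ pureZ rmorph0 mul0r scale0r. Qed.

Let h_base r : h (alg_map A r) = Sqz (alg_map S r) 0.
Proof.
rewrite /h value0Z (_ : linear_form_of _ = 0) ?pure0 //.
by apply: fixed_inj; exact: linear_part_base.
Qed.

Let h1 : h 1 = 1.
Proof. by rewrite -(rmorph1 (alg_map A)) h_base rmorph1. Qed.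

Let hM : {morph h : a b / a * b}.
Proof.
move=> a b; rewrite /h SqzM value0M rmorphM; congr (Sqz _ _).
rewrite -!pureZ -[X in pure _ X + _]mulr1 -[X in _ + pure _ X]mulr1 -!pure_baseZ -pureDl.
by congr (pure _ _); apply: fixed_inj; exact: linear_partM.
Qed.

Definition universal_point_hom : alg_hom A E :=
  @AlgHom R A E (mk_rmorphism hD h1 hM) h_base.

Definition universal_point : F E := fmap universal_point_hom u.

Lemma classify_universal_point a : classify universal_point a =
  Sqz (alg_map S (value0 a)) (pure (linear_form_of a) (1 : S)).
Proof. by rewrite (@classify_uniq _ _ universal_point_hom). Qed.

End UniversalPoint.

(** A linear form n satisfies n(0) = 0 and pi n = n, which gives its value at the tautological
    point; specializing that point along y gives a(0) + eps (pi a)(y), which is a(eps y). *)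
Lemma representable_transpose_iso : rmod_iso (transpose evaluate).
Proof.
apply: (@transpose_iso _ _ _ _ universal_point) => [S n|S T y].
  rewrite [LHS]coef_evaluate classify_universal_point.
  have [_] := linear_part_idem (fixed_val n).
  rewrite value_linear_form => ->; rewrite rmorph0; congr (Sqz _ (pure _ _)).
  by apply: fixed_inj; exact: value_linear_form.
apply: classify_ext => a; rewrite classify_fmap classify_universal_point.
rewrite [LHS]pairing_homE classify_nilpotent; last first.
  by rewrite /eps SqzM mul0r !scale0r addr0.
rewrite classify_fmap [X in _ = _ + X]eps_mul /pairing transpose_pure rmorph1 mul1r.
by rewrite [coef _ _]coef_evaluate /= SqzD addr0 add0r.
Qed.

End RepresentableTranspose.

(** * The symmetric algebra *)

Section SymmetricAlgebra.
Variables (R : comPzRingType) (M : lmodType R).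
Notation D := (dual (quasi_coherent M)).

Inductive sym_term :=
| SymBase of R
| SymGen of M
| SymAdd of sym_term & sym_term
| SymOpp of sym_term
| SymMul of sym_term & sym_term.

Fixpoint sym_eval (S : algebra R) (phi : D S) (t : sym_term) : S :=
  match t with
  | SymBase r => alg_map S r
  | SymGen m => coef phi m
  | SymAdd t1 t2 => sym_eval phi t1 + sym_eval phi t2
  | SymOpp t1 => - sym_eval phi t1
  | SymMul t1 t2 => sym_eval phi t1 * sym_eval phi t2
  end.

(* Quantifying over all algebras, instead of generating the congruence by the  *)
(* ring axioms, makes these axioms hold by evaluation; the relation is in      *)
(* [Prop], so that the quotient stays in the universe of M.                    *)
Definition sym_eqb (t1 t2 : sym_term) : bool :=
  `[< forall (S : algebra R) (phi : D S), sym_eval phi t1 = sym_eval phi t2 >].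

Lemma sym_eqb_refl : reflexive sym_eqb.
Proof. by move=> t; apply/asboolP. Qed.
Lemma sym_eqb_sym : symmetric sym_eqb.
Proof. by move=> t1 t2; apply/asboolP/asboolP => E S phi; rewrite E. Qed.
Lemma sym_eqb_trans : transitive sym_eqb.
Proof.
by move=> t2 t1 t3 /asboolP E /asboolP F; apply/asboolP => S phi; rewrite E F.
Qed.

HB.instance Definition _ := gen_eqMixin sym_term.
HB.instance Definition _ := gen_choiceMixin sym_term.

Definition sym_equiv := EquivRel sym_eqb sym_eqb_refl sym_eqb_sym sym_eqb_trans.

Definition sym := {eq_quot sym_equiv}.
HB.instance Definition _ := Choice.on sym.

Definition sym_class (t : sym_term) : sym := \pi_sym t.

Lemma sym_classP (a : sym) : exists t, a = sym_class t.
Proof. by exists (repr a); rewrite /sym_class reprK. Qed.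

Lemma sym_class_eq t1 t2 :
  (forall (S : algebra R) (phi : D S), sym_eval phi t1 = sym_eval phi t2) ->
  sym_class t1 = sym_class t2.
Proof. by move=> E; apply/eqmodP/asboolP. Qed.

Definition sym_value (S : algebra R) (phi : D S) (a : sym) : S := sym_eval phi (repr a).

Lemma sym_valueE (S : algebra R) (phi : D S) t :
  sym_value phi (sym_class t) = sym_eval phi t.
Proof.
rewrite /sym_value; have /eqmodP/asboolP : sym_class (repr (sym_class t)) = sym_class t.
  by rewrite /sym_class reprK.
exact.
Qed.

Lemma sym_ext (a b : sym) :
  (forall (S : algebra R) (phi : D S), sym_value phi a = sym_value phi b) -> a = b.
Proof.
have [t ->] := sym_classP a; have [t' ->] := sym_classP b => E.
by apply: sym_class_eq => S phi; rewrite -!sym_valueE.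
Qed.

Definition sym_add (a b : sym) := sym_class (SymAdd (repr a) (repr b)).
Definition sym_opp (a : sym) := sym_class (SymOpp (repr a)).
Definition sym_mul (a b : sym) := sym_class (SymMul (repr a) (repr b)).
Definition sym_base (r : R) := sym_class (SymBase r).
Definition sym_gen (m : M) := sym_class (SymGen m).

Section Value.
Variables (S : algebra R) (phi : D S).

Lemma sym_value_add a b : sym_value phi (sym_add a b) = sym_value phi a + sym_value phi b.
Proof. exact: sym_valueE. Qed.
Lemma sym_value_opp a : sym_value phi (sym_opp a) = - sym_value phi a.
Proof. exact: sym_valueE. Qed.
Lemma sym_value_mul a b : sym_value phi (sym_mul a b) = sym_value phi a * sym_value phi b.
Proof. exact: sym_valueE. Qed.
Lemma sym_value_base r : sym_value phi (sym_base r) = alg_map S r.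
Proof. exact: sym_valueE. Qed.
Lemma sym_value_gen m : sym_value phi (sym_gen m) = coef phi m.
Proof. exact: sym_valueE. Qed.

End Value.

Definition sym_valueP :=
  (sym_value_add, sym_value_opp, sym_value_mul, sym_value_base, sym_value_gen).

Lemma sym_addA : associative sym_add.
Proof. by move=> a b c; apply: sym_ext => S phi; rewrite !sym_valueP addrA. Qed.
Lemma sym_addC : commutative sym_add.
Proof. by move=> a b; apply: sym_ext => S phi; rewrite !sym_valueP addrC. Qed.
Lemma sym_add0 : left_id (sym_base 0) sym_add.
Proof. by move=> a; apply: sym_ext => S phi; rewrite !sym_valueP rmorph0 add0r. Qed.
Lemma sym_addN : left_inverse (sym_base 0) sym_opp sym_add.
Proof. by move=> a; apply: sym_ext => S phi; rewrite !sym_valueP rmorph0 addNr. Qed.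
Lemma sym_mulA : associative sym_mul.
Proof. by move=> a b c; apply: sym_ext => S phi; rewrite !sym_valueP mulrA. Qed.
Lemma sym_mulC : commutative sym_mul.
Proof. by move=> a b; apply: sym_ext => S phi; rewrite !sym_valueP mulrC. Qed.
Lemma sym_mul1 : left_id (sym_base 1) sym_mul.
Proof. by move=> a; apply: sym_ext => S phi; rewrite !sym_valueP rmorph1 mul1r. Qed.
Lemma sym_mulDl : left_distributive sym_mul sym_add.
Proof. by move=> a b c; apply: sym_ext => S phi; rewrite !sym_valueP mulrDl. Qed.

HB.instance Definition _ := GRing.isZmodule.Build sym
  sym_addA sym_addC sym_add0 sym_addN.
HB.instance Definition _ := GRing.Zmodule_isComPzRing.Build sym
  sym_mulA sym_mulC sym_mul1 sym_mulDl.

Lemma sym_baseD : {morph sym_base : r s / r + s}.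
Proof. by move=> r s; apply: sym_ext => S phi; rewrite !sym_valueP rmorphD. Qed.
Lemma sym_baseM : {morph sym_base : r s / r * s}.
Proof. by move=> r s; apply: sym_ext => S phi; rewrite !sym_valueP rmorphM. Qed.

Definition sym_alg : algebra R :=
  @Algebra R sym (mk_rmorphism sym_baseD (erefl : sym_base 1 = 1) sym_baseM).

Lemma sym_genD : {morph sym_gen : m n / m + n}.
Proof. by move=> m n; apply: sym_ext => S phi; rewrite !sym_valueP coef_linD. Qed.

Lemma sym_genZ r m : sym_gen (r *: m) = alg_map sym_alg r * sym_gen m.
Proof. by apply: sym_ext => S phi; rewrite !sym_valueP coef_linZ. Qed.

Definition sym_universal : D sym_alg := @functional R M sym_alg sym_gen sym_genD sym_genZ.

(** A point phi corresponds to evaluation of terms at phi; uniqueness is by induction on terms. *)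
Lemma sym_represents : @represents R D sym_alg sym_universal.
Proof.
move=> S phi.
have v1 : sym_value phi 1 = 1 by rewrite sym_value_base rmorph1.
pose v : alg_hom sym_alg S := @AlgHom R sym_alg S
  (mk_rmorphism (sym_value_add phi) v1 (sym_value_mul phi)) (sym_value_base phi).
exists v; split=> [|f fE].
  apply: dual_qc_ext => m; rewrite coef_fmap coef_functional; exact: sym_value_gen.
apply: alg_hom_ext => a; have [t ->] := sym_classP a.
rewrite [RHS]sym_valueE; elim: t => [r|m|t IHt t' IHt'|t IHt|t IHt t' IHt'] /=.
- exact: (alg_homP f r).
- by rewrite -fE coef_fmap coef_functional.
- rewrite -IHt -IHt' -rmorphD; congr (f _).
  by apply: sym_ext => T psi; rewrite sym_value_add !sym_valueE.
- rewrite -IHt -rmorphN; congr (f _).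
  by apply: sym_ext => T psi; rewrite sym_value_opp !sym_valueE.
- rewrite -IHt -IHt' -rmorphM; congr (f _).
  by apply: sym_ext => T psi; rewrite sym_value_mul !sym_valueE.
Qed.

End SymmetricAlgebra.

(** * Functors isomorphic to the dual of a quasi-coherent module *)

Section DualOfQuasiCoherent.
Variables (R : comPzRingType) (M : lmodType R) (F : rmodule R).
Variable f : rmod_hom F (dual (quasi_coherent M)).
Hypothesis f_iso : rmod_iso f.

Let f_inj S : injective (f S).
Proof. by apply: bij_inj; move: S; exact/rmod_isoP. Qed.

Let f_surj S (phi : dual (quasi_coherent M) S) : exists x, f S x = phi.
Proof. by have [g gP] := f_iso; exists (g S phi); have [_] := gP S. Qed.

Lemma dual_qc_representable : exists (A : algebra R) (u : F A), represents u.
Proof.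
have [u uE] := f_surj (sym_universal M); exists (sym_alg M), u => S x.
have [h [hE h_uniq]] := sym_represents (f S x).
exists h; split=> [|g gE]; first by apply: f_inj; rewrite rmod_hom_nat uE.
by apply: h_uniq; rewrite -uE -rmod_hom_nat gE.
Qed.

(** The tautological point is a preimage under [f] of the functional sending m to m tensor 1;
    injectivity of [f] reduces its specialization property to coefficients. *)
Lemma dual_qc_transpose_iso : rmod_iso (transpose f).
Proof.
pose l S (m : M) : alg_restr (sqz_alg (tensor M S)) := Sqz 0 (pure m (1 : S)).
have lD S : {morph l S : m n / m + n}.
  by move=> m n; rewrite /l SqzD addr0 -pureDl.
have lZ S r m : l S (r *: m) = alg_map (alg_restr (sqz_alg (tensor M S))) r * l S m.
  by rewrite /l /= SqzM mulr0 scale0r addr0 -pureZ pure_baseZ mulr1.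
pose x S := projT1 (cid (f_surj (functional (lD S) (lZ S)))).
have coef_x S n : coef (f _ (x S)) n = l S n.
  by rewrite /x; case: cid => y /= ->; rewrite coef_functional.
apply: (@transpose_iso _ _ _ _ x) => // S T y.
apply: f_inj; apply: dual_qc_ext => n.
rewrite rmod_hom_nat coef_fmap coef_x [LHS]pairing_homE.
rewrite rmod_homZ coefZ rmod_hom_nat coef_fmap [RHS]eps_mul.
by rewrite rmorph0 /pairing transpose_pure rmorph1 mul1r.
Qed.

End DualOfQuasiCoherent.

(* [ms_rmodule X] is the R-module X^., and [dual (quasi_coherent M)] is the
   dual of the functor S |-> M (x)_R S. *)
Theorem proposition0p1 (R : comPzRingType) (X : module_scheme R) :
  (exists M : lmodType R,
     rmod_isomorphic (ms_rmodule X) (dual (quasi_coherent M))) <->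
  (is_affine X /\ reflexive_rmodule (ms_rmodule X)).
Proof.
split=> [[M [f f_iso]]|[Xaff Xrefl]].
  split.
    have [A [u uP]] := dual_qc_representable f_iso.
    exact: representable_affine uP.
  exact/(reflexive_iff_iso (dual_qc_transpose_iso f_iso)).
have [A [u uP]] := affine_representable Xaff.
exists (@linear_forms R (ms_rmodule X) A u uP), (@evaluate R (ms_rmodule X) A u uP).
exact/(reflexive_iff_iso (@representable_transpose_iso R (ms_rmodule X) A u uP)).
Qed.
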